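(* Let $G=\widetilde{\mathrm{SL}}_2(\mathbb{R})$ with Lie algebra $\mathfrak{g}=\mathfrak{sl}_2(\mathbb{R})$ and Killing form $K(V,W)=\operatorname{tr}(\operatorname{ad}V\circ\operatorname{ad}W)$. Consider a left-invariant generalized sub-Lorentzian structure on $G$ given by a closed convex acute cone $C^+\subset\mathfrak{g}$ at the identity and an upper semicontinuous anti-norm. If $C^+\setminus\{0\}$ is contained in the interior of the cone $\{v\in\mathfrak{g}: K(v,v)\le 0\}$, then for every point $x_1$ attainable from the identity there exists a longest arc from the identity to $x_1$ (and by left-invariance, the same holds for any starting point $x_0$ and any $x_1$ attainable from $x_0$).
   Context: A generalized sub-Lorentzian structure on a smooth manifold $M$ assigns to each $x\in M$ a closed convex acute cone $C^+_x\subset T_xM$ (acute: containing no nonzero linear subspace) and an anti-norm $\nu_x:T_xM\to\mathbb{R}\cup\{-\infty\}$, i.e. $\nu_x\ge 0$ on $C^+_x$, $\nu_x=-\infty$ outside $C^+_x$, $\nu_x(\lambda v)=\lambda\nu_x(v)$ for $\lambda>0$, and $\nu_x(v+w)\ge\nu_x(v)+\nu_x(w)$. On a Lie group it is left-invariant if $C^+_g=(L_g)_*C^+_{\mathrm{id}}$ and $\nu_g((L_g)_*v)=\nu_{\mathrm{id}}(v)$. An admissible curve is a Lipschitz curve $x:[0,t_1]\to M$ with $\dot x(t)\in C^+_{x(t)}\setminus\{0\}$ for a.e. $t$; its length is $\int_0^{t_1}\nu(\dot x(t))\,dt$. A point $x_1$ is attainable from $x_0$ if some admissible curve goes from $x_0$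 to $x_1$. A longest arc from $x_0$ to $x_1$ is an admissible curve from $x_0$ to $x_1$ whose length equals the (finite) supremum of lengths of all admissible curves from $x_0$ to $x_1$. *)

(* Defs.v *)
From HB Require Import structures.
From mathcomp Require Import all_boot all_order all_algebra.
From mathcomp Require Import all_classical all_reals all_analysis.
Set Implicit Arguments. Unset Strict Implicit. Unset Printing Implicit Defensive.
Import Order.TTheory GRing.Theory Num.Theory.
Local Open Scope classical_set_scope.
Local Open Scope ring_scope.

Section Defs.
Variable R : realType.
Notation M := 'M[R]_2.

Definition in_sl2 (v : M) : Prop := \tr v = 0.

Definition slH : M := \matrix_(i, j) (if i == j then (if i == 0 then 1 else -1) else 0).
Definition slE : M := \matrix_(i, j) (if (i == 0) && (j == 1) then 1 else 0).
Definition slF : M := \matrix_(i, j) (if (i == 1) && (j == 0) then 1 else 0).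
Definition slcoordH (X : M) : R := X 0 0.
Definition slcoordE (X : M) : R := X 0 1.
Definition slcoordF (X : M) : R := X 1 0.

Definition ad (V W : M) : M := V *m W - W *m V.

(* K(V,W) = tr(ad V o ad W), the trace computed in the basis (H,E,F) of sl_2 *)
Definition killing (V W : M) : R :=
  slcoordH (ad V (ad W slH)) + slcoordE (ad V (ad W slE)) + slcoordF (ad V (ad W slF)).

Definition mx_close (v w : M) (e : R) : Prop := forall i j, `|w i j - v i j| < e.

Definition in_int_killing_cone (v : M) : Prop :=
  in_sl2 v /\ exists2 e : R, 0 < e &
    forall w, in_sl2 w -> mx_close v w e -> killing w w <= 0.

Definition closed_set (C : set M) : Prop :=
  forall v, (forall e : R, 0 < e -> exists2 w, C w & mx_close v w e) -> C v.

Definition closed_convex_acute_cone (C : set M) : Prop :=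
  [/\ C `<=` in_sl2 /\ closed_set C, C 0,
      (forall v w, C v -> C w -> C (v + w)),
      (forall (l : R) v, 0 < l -> C v -> C (l *: v)) &
      (forall v, C v -> C (- v) -> v = 0)].

Definition anti_norm (C : set M) (nu : M -> \bar R) : Prop :=
  [/\ (forall v, nu v < +oo)%E,
      (forall v, C v -> 0 <= nu v)%E,
      (forall v, ~ C v -> nu v = -oo)%E,
      (forall (l : R) v, 0 < l -> nu (l *: v) = (l%:E * nu v)%E) &
      (forall v w, nu v + nu w <= nu (v + w)%R)%E].

Definition upper_semicontinuous (nu : M -> \bar R) : Prop :=
  forall v (a : R), (nu v < a%:E)%E ->
    exists2 e : R, 0 < e & forall w, mx_close v w e -> (nu w < a%:E)%E.

(* A point of G is a pair (X, th) with X in SL_2(R) and th a (real) angle of the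
   first column of X; the covering map is (X, th) |-> X. *)
Definition angle_of (X : M) (th : R) : Prop :=
  X 0 0 = Num.sqrt (X 0 0 ^+ 2 + X 1 0 ^+ 2) * cos th /\
  X 1 0 = Num.sqrt (X 0 0 ^+ 2 + X 1 0 ^+ 2) * sin th.

Definition in_G (X : M) (th : R) : Prop := \det X = 1 /\ angle_of X th.

Definition mx_derivable (g : R -> M) (t : R) : Prop :=
  forall i j, derivable (fun s => g s i j) t 1.
Definition mx_deriv (g : R -> M) (t : R) : M :=
  \matrix_(i, j) derive1 (fun s => g s i j) t.

Definition body_vel (g : R -> M) (t : R) : M := invmx (g t) *m mx_deriv g t.

(* A curve in G on [0,t1] is given by a curve g in SL_2(R) together with a continuous
   angle th of its first column (i.e. the lift to the universal cover). *)
Definition admissible (C : set M) (t1 : R) (g : R -> M) (th : R -> R) : Prop :=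
  [/\ 0 <= t1,
      (forall t, 0 <= t <= t1 -> in_G (g t) (th t)),
      (exists k : R, forall s t i j, 0 <= s <= t1 -> 0 <= t <= t1 ->
          `|g s i j - g t i j| <= k * `|s - t|),
      (forall t, 0 <= t <= t1 -> forall e : R, 0 < e -> exists2 d : R, 0 < d &
         forall s, 0 <= s <= t1 -> `|s - t| < d -> `|th s - th t| < e) &
      {ae (@lebesgue_measure R), forall t, t \in `[0, t1] ->
          mx_derivable g t /\ C (body_vel g t) /\ body_vel g t != 0}].

Definition from_to (t1 : R) (g : R -> M) (th : R -> R) (X0 : M) (th0 : R)
  (X1 : M) (th1 : R) : Prop :=
  [/\ g 0 = X0, th 0 = th0, g t1 = X1 & th t1 = th1].

Definition curve_length (nu : M -> \bar R) (t1 : R) (g : R -> M) : \bar R :=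
  (\int[@lebesgue_measure R]_(t in `[0%R, t1]%classic) nu (body_vel g t))%E.

Definition attainable (C : set M) (X0 : M) (th0 : R) (X1 : M) (th1 : R) : Prop :=
  exists t1 g th, admissible C t1 g th /\ from_to t1 g th X0 th0 X1 th1.

Definition sup_length (C : set M) (nu : M -> \bar R) (X0 : M) (th0 : R)
  (X1 : M) (th1 : R) : \bar R :=
  ereal_sup [set L | exists t1 g th, [/\ admissible C t1 g th,
                from_to t1 g th X0 th0 X1 th1 & L = curve_length nu t1 g]].

Definition longest_arc (C : set M) (nu : M -> \bar R) (X0 : M) (th0 : R)
  (X1 : M) (th1 : R) (t1 : R) (g : R -> M) (th : R -> R) : Prop :=
  [/\ admissible C t1 g th, from_to t1 g th X0 th0 X1 th1,
      sup_length C nu X0 th0 X1 th1 \is a fin_num &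
      curve_length nu t1 g = sup_length C nu X0 th0 X1 th1].

End Defs.

(* Main.v *)
(** Write a point of the universal cover as a matrix X = [[a, b], [c, d]] with an
    angle. The argument of z = (a + d) + i (c - b) is a time function: along a curve
    with velocity v = [[p, q], [r, -p]] it moves at the rate alpha + Im (...), with
    alpha = (r - q) / 2, and the error is at most |beta|, beta = (p, (q + r) / 2).
    Being inside the Killing cone means |beta| < |alpha|, and by compactness
    |beta| <= (1 - delta) |alpha| on C. Hence all admissible curves between two given
    points, parametrised by this argument, are uniformly bounded and uniformly
    Lipschitz (Gronwall).

    Adjoin to such a curve g a function y with y' <= nu (g^-1 g'). The mxdot (v, y')
    lies in the hypograph of nu, a closed convex cone, and by the bipolar theorem
    this is a family of linear inequalities, which integrate to inequalities between
    increments of g and y. These pass to pointwise limits, so by Tychonoff the set of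
    such (g, y) is compact and y (1) attains a maximum on it. Lipschitz functions are
    a.e. differentiable and are primitives of their derivatives, hence the maximiser
    is an admissible curve of length at least y (1). Conversely every length is a
    supremum of integrals of simple functions below nu (g^-1 g'), each of which
    provides such a y; no measurability of nu is needed. *)
Require Import Defs.
From HB Require Import structures.
From mathcomp Require Import all_boot all_order all_algebra.
From mathcomp Require Import all_classical all_reals all_analysis.
From mathcomp Require Import ring lra measurable_realfun.
Set Implicit Arguments. Unset Strict Implicit. Unset Printing Implicit Defensive.
Import Order.TTheory GRing.Theory Num.Theory.
Import numFieldNormedType.Exports.
Local Open Scope classical_set_scope.
Local Open Scope ring_scope.

(** * Pointwise derivatives *)

Section PointwiseDerivatives.
Variable R : realType.
Implicit Types (f g : R -> R) (x a b c : R).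

Lemma isd_cst c x : is_derive x 1 (fun _ : R => c) 0.
Proof. exact: is_derive_cst. Qed.

Lemma isd_id x : is_derive x 1 (fun t : R => t) 1.
Proof. exact: is_derive_id. Qed.

Lemma isdD f g x a b : is_derive x 1 f a -> is_derive x 1 g b ->
  is_derive x 1 (fun t => f t + g t) (a + b).
Proof. by move=> fa gb; exact: is_deriveD. Qed.

Lemma isdN f x a : is_derive x 1 f a -> is_derive x 1 (fun t => - f t) (- a).
Proof. by move=> fa; exact: is_deriveN. Qed.

Lemma isdB f g x a b : is_derive x 1 f a -> is_derive x 1 g b ->
  is_derive x 1 (fun t => f t - g t) (a - b).
Proof. by move=> fa gb; exact: is_deriveB. Qed.

Lemma isdM f g x a b : is_derive x 1 f a -> is_derive x 1 g b ->
  is_derive x 1 (fun t => f t * g t) (a * g x + f x * b).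
Proof.
move=> fa gb.
suff -> : a * g x + f x * b = f x *: b + g x *: a by exact: is_deriveM.
by rewrite /GRing.scale/= addrC (mulrC a).
Qed.

Lemma isdZ c f x a : is_derive x 1 f a -> is_derive x 1 (fun t => c * f t) (c * a).
Proof. by move=> fa; exact: is_deriveZ. Qed.

Lemma isd_sqr f x a : is_derive x 1 f a ->
  is_derive x 1 (fun t => f t ^+ 2) (2 * f x * a).
Proof.
move=> fa; have -> : 2 * f x * a = a * f x + f x * a by ring.
exact: isdM.
Qed.

Lemma isd_comp f g x a b : is_derive x 1 f a -> is_derive (f x) 1 g b ->
  is_derive x 1 (fun t => g (f t)) (b * a).
Proof. by move=> fa gb; have := @is_derive1_comp _ g f x b a gb fa. Qed.

Lemma isd_expR f x a : is_derive x 1 f a ->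
  is_derive x 1 (fun t => expR (f t)) (expR (f x) * a).
Proof. by move=> fa; apply: isd_comp. Qed.

Lemma isd_sin f x a : is_derive x 1 f a ->
  is_derive x 1 (fun t => sin (f t)) (cos (f x) * a).
Proof. by move=> fa; apply: isd_comp. Qed.

Lemma isd_cos f x a : is_derive x 1 f a ->
  is_derive x 1 (fun t => cos (f t)) (- sin (f x) * a).
Proof. by move=> fa; apply: isd_comp. Qed.

Lemma isd_derive1 f x a : is_derive x 1 f a -> derivable f x 1 /\ derive1 f x = a.
Proof. by move=> fa; rewrite derive1E derive_val. Qed.

Lemma isd_uniq f x a b : is_derive x 1 f a -> is_derive x 1 f b -> a = b.
Proof. by move=> /isd_derive1[_ <-] /isd_derive1[_ <-]. Qed.

Lemma derivable_isd f x : derivable f x 1 -> is_derive x 1 f (derive1 f x).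
Proof. by move=> df; rewrite derive1E; split. Qed.
End PointwiseDerivatives.

(** * Lipschitz functions and the Lebesgue integral *)

Section Density.
Variable R : realType.
Notation mu := (@lebesgue_measure R).

Lemma lipschitz_continuous_real (F : R -> R) (k : R) :
  (forall x y, `|F x - F y| <= k * `|x - y|) -> continuous F.
Proof.
move=> kF x; apply/cvgrPdist_lt => e e0.
have k0 : 0 < `|k| + 1 by rewrite ltr_wpDl.
near=> y.
apply: (le_lt_trans (kF _ _)).
apply: (@le_lt_trans _ _ ((`|k| + 1) * `|x - y|)).
  by apply: ler_wpM2r => //; rewrite (le_trans (ler_norm _))// lerDl.
rewrite mulrC -ltr_pdivlMr//.
near: y; apply: cvgr_dist_lt => //; exact: divr_gt0.
Unshelve. all: by end_near. Qed.

Section LS.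
Variables (G : R -> R).
Hypothesis G_nd : nondecreasing G.
Hypothesis G_cont : continuous G.
HB.instance Definition _ := isCumulative.Build R _ R G G_nd (right_continuousW G_cont).
Definition cumul : cumulative R R := G.
End LS.

Lemma LS_itv (G : R -> R) (nd : nondecreasing G) (cG : continuous G) (a b : R) :
  a <= b -> lebesgue_stieltjes_measure (cumul nd cG) `]a, b]%classic = (G b - G a)%:E.
Proof.
move=> ab; rewrite /lebesgue_stieltjes_measure /measure_extension/=.
rewrite measurable_mu_extE/=; last exact: is_ocitv.
by rewrite wlength_itv_bnd.
Qed.

(** The Stieltjes measures of [G] and of [x - G x] add up to Lebesgue measure on half-open
    intervals, hence on all measurable sets by uniqueness; the second summand is nonnegative. *)
Lemma LS_le_lebesgue (G : R -> R) (nd : nondecreasing G) (cG : continuous G)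
    (nd' : nondecreasing (fun x => x - G x)) (A : set R) :
  measurable A ->
  (lebesgue_stieltjes_measure (cumul nd cG) A <= mu A)%E.
Proof.
move=> mA.
have cH : continuous (fun x => x - G x).
  by move=> x; apply: cvgB; [exact: cvg_id|exact: cG].
pose m1 := lebesgue_stieltjes_measure (cumul nd cG).
pose m2 := lebesgue_stieltjes_measure (cumul nd' cH).
have -> : mu A = measure_add m1 m2 A.
  apply: (@lebesgue_stieltjes_measure_unique R idfun (measure_add m1 m2)) => //.
  move=> X /ocitvP[->|[[a b] /= ab ->]].
    by rewrite !measure0.
  have e1 : m1 `]a, b]%classic = (G b - G a)%:E by exact/LS_itv/ltW.
  have e2 : m2 `]a, b]%classic = (b - G b - (a - G a))%:E by exact/LS_itv/ltW.
  have e3 : mu `]a, b]%classic = (b - a)%:E.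
    by rewrite lebesgue_measure_itv/= lte_fin ab EFinB.
  transitivity (m1 `]a, b]%classic + m2 `]a, b]%classic)%E; last first.
    by rewrite -[RHS]/(measure_add m1 m2 _) measure_addE.
  rewrite e1 e2 -EFinD; transitivity ((b - a)%:E); last by congr (_%:E); lra.
  by rewrite -e3.
by rewrite measure_addE leeDl.
Qed.

(** Radon-Nikodym, applied to the Stieltjes measure of [G] restricted to []a, b]] to make it finite,
    yields the density; [FTC1] identifies it with the derivative almost everywhere. *)
Lemma monotone_density (G : R -> R) (nd : nondecreasing G) (cG : continuous G)
    (nd' : nondecreasing (fun x => x - G x)) (a b : R) : a < b ->
  exists h : R -> R, [/\ mu.-integrable setT (EFin \o h),
    {ae mu, forall x, a < x < b -> is_derive x 1 G (h x)} &
    forall t, a <= t <= b ->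
      (\int[mu]_(x in `]a, t]%classic) (h x)%:E = (G t - G a)%:E)%E].
Proof.
move=> ab.
pose m1 : {measure set (measurableTypeR R) -> \bar R} :=
  lebesgue_stieltjes_measure (cumul nd cG).
have mab : measurable (`]a, b]%classic : set (measurableTypeR R)) by [].
have m1ab : (m1 `]a, b]%classic < +oo)%E.
  by rewrite [X in (X < _)%E](LS_itv nd cG (ltW ab)) ltry.
pose nu : {finite_measure set (measurableTypeR R) -> \bar R} := mfrestr mab m1ab.
have numu : nu `<< mu.
  apply/null_content_dominatesP => A mA muA0.
  apply/eqP; rewrite eq_le measure_ge0 andbT -muA0.
  rewrite /nu /= /mfrestr /mrestr.
  apply: (@le_trans _ _ (mu (A `&` `]a, b]))).
    by apply: LS_le_lebesgue => //; exact: measurableI.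
  by apply: le_measure; rewrite ?inE//; exact: measurableI.
have [f [f0 ffin fint fE]] := radon_nikodym_sigma_finite numu.
have hE : EFin \o (fine \o f) = f by apply/funext => x /=; rewrite fineK.
exists (fine \o f).
have intE t : a <= t <= b ->
    (\int[mu]_(x in `]a, t]%classic) (fine (f x))%:E = (G t - G a)%:E)%E.
  move=> /andP[at_ tb]; rewrite -[LHS]/(\int[mu]_(x in `]a, t]%classic) (EFin \o (fine \o f)) x)%E.
  rewrite hE -fE// /nu /= /mfrestr /mrestr setIidl; last first.
    by apply: subset_itvl; rewrite bnd_simp.
  by rewrite LS_itv.
split; first by rewrite hE.
  have i1 y : mu.-integrable [set` Interval (BRight a) (BRight y)] (EFin \o (fine \o f)).
    by rewrite hE; apply: (integrableS _ _ _ fint).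
  have i2 : locally_integrable [set: R] (fine \o f).
    by apply: open_integrable_locally; [exact: openT|rewrite hE].
  have := FTC1 i1 i2.
  apply: filterS; first exact: (ae_filter_ringOfSetsType mu).
  move=> x H /andP[ax xb].
  have [|dF F'] := H; first exact: ax.
  have dF' : is_derive x 1 (fun t => Rintegral mu `]a, t]%classic (fine \o f) + G a) (fine (f x)).
    rewrite -[X in is_derive _ _ _ X]addr0; apply: isdD (isd_cst _ _).
    by move: (derivable_isd dF); rewrite F'.
  apply: near_eq_is_derive dF'.
  near=> t.
  have /andP[a_t tb] : a < t < b.
    by near: t; apply: (@near_in_itvoo _ a b x); rewrite in_itv/= ax.
  rewrite /Rintegral intE/= ?subrK// !ltW//.
by [].
Unshelve. all: by end_near. Qed.

(** The retraction onto [[a, b]]; composing with it extends a Lipschitz function on the interval to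
    the whole line. *)
Definition clamp (a b x : R) : R := Num.max a (Num.min x b).

Lemma clamp_in (a b x : R) : a <= b -> a <= clamp a b x <= b.
Proof.
move=> ab; rewrite /clamp le_max lexx/= ge_max ab/=.
by rewrite ge_min lexx orbT.
Qed.

Lemma clamp_id (a b x : R) : a <= x <= b -> clamp a b x = x.
Proof.
by move=> /andP[ax xb]; rewrite /clamp (min_idPl xb) (max_idPr ax).
Qed.

Lemma clamp_lip (a b x y : R) : a <= b -> `|clamp a b x - clamp a b y| <= `|x - y|.
Proof.
move=> ab; wlog xy : x y / x <= y.
  move=> H; have [/H//|/ltW/H] := leP x y.
  by rewrite (distrC (clamp _ _ y)) (distrC y).
rewrite !(distrC _ (clamp _ _ y)) (distrC x) (ger0_norm (_ : 0 <= y - x)) ?subr_ge0//.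
rewrite /clamp /Num.max /Num.min; do ! case: ifPn; rewrite -?leNgt => *;
  rewrite ler_norml; apply/andP; split; lra.
Qed.

(** For a positive Lipschitz constant [K], both [G = (x + F / K) / 2] and [x - G] are nondecreasing,
    so the monotone case applies to [G]; solving for [F] gives the density [K * (2 * g - 1)]. *)
Lemma lipschitz_density (F : R -> R) (k a b : R) : a < b ->
  (forall x y, a <= x <= b -> a <= y <= b -> `|F x - F y| <= k * `|x - y|) ->
  exists h : R -> R, [/\ mu.-integrable `[a, b]%classic (EFin \o h),
    {ae mu, forall x, a < x < b -> is_derive x 1 F (h x)} &
    \int[mu]_(x in `[a, b]%classic) h x = F b - F a].
Proof.
move=> ab kF; pose K : R := `|k| + 1.
have K0 : 0 < K by rewrite ltr_wpDl.
pose Fc x := F (clamp a b x).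
have KFc x y : `|Fc x - Fc y| <= K * `|x - y|.
  apply: (le_trans (kF _ _ (clamp_in _ (ltW ab)) (clamp_in _ (ltW ab)))).
  apply: (@le_trans _ _ (K * `|clamp a b x - clamp a b y|)).
    by apply: ler_wpM2r => //; rewrite /K (le_trans (ler_norm _))// lerDl.
  by apply: ler_wpM2l; [exact: ltW|exact/clamp_lip/ltW].
pose G x := (x + K^-1 * Fc x) / 2.
have cG : continuous G.
  move=> x; apply: cvgM; last exact: cvg_cst.
  apply: cvgD; first exact: cvg_id.
  by apply: cvgM; [exact: cvg_cst|exact: (lipschitz_continuous_real KFc)].
have Kxy x y : x <= y -> `|K^-1 * Fc y - K^-1 * Fc x| <= y - x.
  move=> xy; rewrite -mulrBr  normrM ger0_norm ?invr_ge0 ?(ltW K0)//.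
  rewrite ler_pdivrMl// (le_trans (KFc _ _))//.
  by rewrite ger0_norm ?subr_ge0.
have nd : nondecreasing G.
  move=> x y xy; have := Kxy _ _ xy; rewrite ler_norml /G => /andP[h1 h2]; lra.
have nd' : nondecreasing (fun x => x - G x).
  move=> x y xy; have := Kxy _ _ xy; rewrite ler_norml /G => /andP[h1 h2].
  by rewrite /=; lra.
have [g [gint gae gE]] := monotone_density nd cG nd' ab.
pose h x : R := K * (2 * g x - 1).
have sub : mu.-integrable `[a, b]%classic (EFin \o g).
  by apply: (integrableS _ _ _ gint).
have mub : (mu `[a, b]%classic < +oo)%E.
  by rewrite lebesgue_measure_itv/=; case: ifP => _; rewrite ?ltry// -EFinB ltry.
have i2g : mu.-integrable `[a, b]%classic (EFin \o (fun x => 2 * g x)).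
  have -> : EFin \o (fun x => 2 * g x) = (fun x => (2%:E * (EFin \o g) x)%E) by [].
  exact: integrableZl.
have i1 : mu.-integrable `[a, b]%classic (EFin \o (cst 1 : R -> R)).
  apply: measurable_bounded_integrable => //.
  exact: bounded_cst.
have i3 : mu.-integrable `[a, b]%classic (EFin \o (fun x => 2 * g x - 1)).
  have -> : EFin \o (fun x => 2 * g x - 1) =
     ((EFin \o (fun x => 2 * g x)%R) \- (EFin \o (cst 1%R : R -> R)))%E by [].
  exact: integrableB.
exists h; split.
- have -> : EFin \o h = (fun x => (K%:E * (EFin \o (fun x => 2 * g x - 1)%R) x)%E) by [].
  exact: integrableZl.
- apply: filterS gae; first exact: (ae_filter_ringOfSetsType mu).
  move=> x H /[dup] xab /H dG.
  have dF : is_derive x 1 (fun t => K * (2 * G t - t)) (h x).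
    exact: (isdZ _ (isdB (isdZ _ dG) (isd_id _))).
  apply: near_eq_is_derive dF.
  near=> t.
  have /andP[a_t tb] : a < t < b.
    by near: t; apply: (@near_in_itvoo _ a b x); rewrite in_itv/=.
  rewrite /G /Fc clamp_id; last by rewrite !ltW.
  by field; rewrite gt_eqF.
- rewrite RintegralZl// RintegralB// RintegralZl//.
  rewrite Rintegral_cst// /Rintegral -integral_itv_obnd_cbnd; last first.
    apply: (measurable_int mu); exact: (integrableS _ _ _ gint).
  rewrite gE ?lexx ?ltW//= lebesgue_measure_itv/= lte_fin ab -EFinB/=.
  rewrite /G /Fc !clamp_id ?lexx ?ltW//.
  by field; rewrite gt_eqF.
Unshelve. all: by end_near. Qed.

Lemma lipschitz_ae_derivable (F : R -> R) (k a b : R) :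
  (forall x y, a <= x <= b -> a <= y <= b -> `|F x - F y| <= k * `|x - y|) ->
  {ae mu, forall x, a < x < b -> derivable F x 1}.
Proof.
move=> kF; have [ab|ba] := ltP a b.
  have [h [_ hae _]] := lipschitz_density ab kF.
  apply: filterS hae; first exact: (ae_filter_ringOfSetsType mu).
  by move=> x H /H [].
apply: aeW => x /andP[ax xb]; by move: (lt_le_trans (lt_trans ax xb) ba); rewrite ltxx.
Qed.

(** The increment of [F] is the integral of its derivative. All comparison estimates along
    admissible curves rest on this criterion. *)
Lemma ae_derive_ge0_le (F : R -> R) (k a b : R) : a <= b ->
  (forall x y, a <= x <= b -> a <= y <= b -> `|F x - F y| <= k * `|x - y|) ->
  {ae mu, forall x, a < x < b -> derivable F x 1 -> 0 <= derive1 F x} ->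
  F a <= F b.
Proof.
rewrite le_eqVlt => /predU1P[->//|ab] kF F'0.
have [h [hi hae hE]] := lipschitz_density ab kF.
rewrite -subr_ge0 -hE /Rintegral fine_ge0//.
have hi' : mu.-integrable `]a, b[%classic (EFin \o h).
  by apply: (integrableS _ _ _ hi) => //; exact: subset_itv_oo_cc.
have mh := measurable_int mu hi'.
rewrite (integral_itv_bndoo _ _ mh).
rewrite (@ae_eq_integral _ _ _ mu _ (EFin \o (fun x => Num.max (h x) 0)))//.
- by apply: integral_ge0 => x _; rewrite lee_fin le_max lexx orbT.
- apply/measurable_EFinP; apply: measurable_maxr; last exact: measurable_cst.
  exact/measurable_EFinP.
- apply: (@filterS2 _ _ (ae_filter_ringOfSetsType mu) _ _ _ _ hae F'0).
  move=> x H1 H2 /=; rewrite in_itv/= => xab.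
  have /isd_derive1[dF F'E] := H1 xab.
  by have := H2 xab dF; rewrite F'E => h0; rewrite (max_idPl h0).
Qed.

(** * Integrals as suprema over simple functions *)

Import HBNNSimple.

(** [f] is not assumed measurable, so the definition of the integral is used: each simple function
    below [f] is measurable and vanishes off [N]. *)
Lemma ge0_integral_ae0 (D N : set R) (f : R -> \bar R) : measurable N -> mu N = 0%E ->
  (forall x, D x -> 0 <= f x)%E -> (forall x, D x -> ~ N x -> f x = 0%E) ->
  (\int[mu]_(x in D) f x = 0)%E.
Proof.
move=> mN N0 f0 fN; apply/eqP; rewrite eq_le integral_ge0// andbT.
rewrite ge0_integralE//; apply: ge_ereal_sup => _ [h hf <-].
rewrite -integralT_nnsfun (@ae_eq_integral _ _ _ mu _ (cst 0%E))//.
- by rewrite integral0.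
- by apply/measurable_EFinP; exact: measurable_funPT.
- exists N; split=> // x /= H; apply: contrapT => Nx; apply: H => _.
  apply/eqP; rewrite eq_le; apply/andP; split; last by rewrite lee_fin fun_ge0.
  apply: (le_trans (hf x)); rewrite patchE; case: ifPn => // /set_mem Dx.
  by rewrite fN.
Qed.

(** Off the exceptional null set, every simple function below the positive part of [h] is also below
    that of [f], and the negative part of [f] integrates to zero. *)
Lemma integral_ge_ae (D : set R) (h : R -> R) (f : R -> \bar R) : measurable D ->
  mu.-integrable D (EFin \o h) ->
  {ae mu, forall x, D x -> ((h x)%:E <= f x)%E /\ (0 <= f x)%E} ->
  (\int[mu]_(x in D) (h x)%:E <= \int[mu]_(x in D) f x)%E.
Proof.
move=> mD ih [N [mN N0 sN]].
have good x : D x -> ~ N x -> ((h x)%:E <= f x)%E /\ (0 <= f x)%E.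
  move=> Dx Nx; apply: contrapT => H; apply: Nx; apply: sN => /= H2.
  exact/H/H2.
have mDN : measurable (D `\` N) by exact: measurableD.
have ihN : mu.-integrable (D `\` N) (EFin \o h).
  by apply: (integrableS _ _ _ ih) => //; exact: subDsetl.
rewrite [leRHS]integralE (@ge0_integral_ae0 _ N f^\-%E)//; last first.
  move=> x Dx Nx; have [_ f0] := good _ Dx Nx.
  by rewrite funenegE; apply/max_idPr; rewrite leeNl oppe0.
rewrite sube0 (negligible_integral mN mD ih N0).
apply: (@le_trans _ _ (\int[mu]_(x in D `\` N) ((EFin \o h)^\+ x))%E).
  apply: le_integral => //; first exact: integrable_funepos.
  by move=> x _; rewrite funeposE le_max lexx.
rewrite !ge0_integralE//; apply: le_ereal_sup => _ [g gh <-]; exists g => //= x.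
apply: (le_trans (gh x)); rewrite !patchE.
case: ifPn => [/set_mem[Dx Nx]|_]; last first.
  by case: ifP => // _; exact: funepos_ge0.
rewrite mem_set//; have [hf f0] := good _ Dx Nx.
by rewrite !funeposE ge_max !le_max hf lexx orbT.
Qed.

Lemma integral_le_nnsfun (D : set R) (f : R -> \bar R) (B : \bar R) :
  (forall h : {nnsfun (measurableTypeR R) >-> R}, (forall x, (h x)%:E <= (f^\+ \_ D) x)%E ->
     (\int[mu]_x (h x)%:E <= B)%E) ->
  (\int[mu]_(x in D) f x <= B)%E.
Proof.
move=> H; rewrite integralE; apply: (@le_trans _ _ (\int[mu]_(x in D) f^\+ x)%E).
  rewrite geeDl// oppe_le0; exact: integral_ge0.
rewrite ge0_integralE//; apply: ge_ereal_sup => _ [h hf <-].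
by rewrite -integralT_nnsfun; apply: (H h) => x; exact: hf.
Qed.

(** Turns a simple function below the length integrand into a Lipschitz function [y] that can be
    compared along the curve. *)
Lemma bounded_primitive (h : R -> R) (k T : R) : 0 <= T ->
  measurable_fun setT h -> (forall x, 0 <= h x <= k) ->
  (forall x, ~ (0 <= x <= T) -> h x = 0) ->
  exists y : R -> R, [/\ y 0 = 0,
    forall x t, 0 <= x <= T -> 0 <= t <= T -> `|y x - y t| <= k * `|x - t|,
    {ae mu, forall x, 0 < x < T -> is_derive x 1 y (h x)} &
    (\int[mu]_x (h x)%:E = (y T)%:E)%E].
Proof.
move=> T0 mh hk hT.
have hb (A : set R) : measurable A -> (mu A < +oo)%E -> mu.-integrable A (EFin \o h).
  move=> mA muA; apply: measurable_bounded_integrable => //.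
    exact: measurable_funTS.
  exists k; split; first exact: num_real.
  move=> x kx t _ /=; have /andP[h0 hk'] := hk t.
  by rewrite ger0_norm// (le_trans hk')// ltW.
have muitv (a b : R) c d : (mu [set` Interval (BSide c a) (BSide d b)] < +oo)%E.
  by rewrite lebesgue_measure_itv/=; case: ifP => _; rewrite ?ltry// -EFinB ltry.
have hT' : mu.-integrable setT (EFin \o h).
  apply/integrableP; split; first exact/measurable_EFinP.
  have /integrableP[_] := hb `[0, T]%classic (measurable_itv _) (muitv _ _ _ _).
  rewrite integral_mkcond; congr (_ < _)%E; apply: eq_integral => x _ /=.
  rewrite patchE; case: ifPn => // /negP; rewrite inE/= in_itv/= => /hT ->.
  by rewrite normr0.
pose y t := \int[mu]_(x in `]0, t]%classic) h x.
exists y; split.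
- by rewrite /y set_itvoc0 Rintegral_set0.
- move=> x t; wlog xt : x t / x <= t.
    move=> H x0 t0; have [/H|/ltW/H] := leP x t; first exact.
    by rewrite distrC (distrC t); exact.
  move=> /andP[x0 xT] /andP[t0 tT].
  rewrite distrC (distrC x) (ger0_norm (_ : 0 <= t - x)) ?subr_ge0//.
  rewrite /y Rintegral_itvB ?bnd_simp//; last exact: hb.
  rewrite ger0_norm; last first.
    by apply: Rintegral_ge0 => z _; have /andP[] := hk z.
  have -> : k * (t - x) = \int[mu]_(z in `]x, t]%classic) (cst k z).
    rewrite Rintegral_cst//= lebesgue_measure_itv/= lte_fin.
    by move: xt; rewrite le_eqVlt => /predU1P[->|->]; rewrite ?ltxx ?subrr ?EFinB.
  apply: le_Rintegral => //.
  + by apply: hb => //; exact: muitv.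
  + apply: measurable_bounded_integrable => //; first exact: muitv.
    by exists `|k|; split; [exact: num_real|move=> M kM z _ /=; exact: ltW].
  + by move=> z _; have /andP[] := hk z.
- have i1 z : mu.-integrable [set` Interval (BRight 0) (BRight z)] (EFin \o h).
    by apply: hb => //; exact: muitv.
  have i2 : locally_integrable [set: R] h.
    by apply: open_integrable_locally; [exact: openT|].
  have := FTC1 i1 i2.
  apply: filterS; first exact: (ae_filter_ringOfSetsType mu).
  move=> x H /andP[x0 xT]; have [|dF F'] := H; first exact: x0.
  by move: (derivable_isd dF); rewrite F'.
- rewrite /y /Rintegral fineK; last exact: integrable_fin_num (hb _ _ _).
  rewrite integral_itv_obnd_cbnd; last by apply/measurable_EFinP/measurable_funTS.
  rewrite [RHS]integral_mkcond; apply: eq_integral => x _.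
  rewrite patchE; case: ifPn => // /negP; rewrite inE/= in_itv/= => /hT ->.
  by [].
Qed.
End Density.

(** * Compactness in products and separation of cones *)

Section ContinuousReal.
Variables (R : realType) (T : topologicalType).
Implicit Types f g : T -> R.

Lemma ctsD f g : continuous f -> continuous g -> continuous (fun x => f x + g x).
Proof. by move=> cf cg x; apply: cvgD; [exact: cf|exact: cg]. Qed.

Lemma ctsN f : continuous f -> continuous (fun x => - f x).
Proof. by move=> cf x; apply: cvgN; exact: cf. Qed.

Lemma ctsB f g : continuous f -> continuous g -> continuous (fun x => f x - g x).
Proof. by move=> cf cg x; apply: cvgB; [exact: cf|exact: cg]. Qed.

Lemma ctsM f g : continuous f -> continuous g -> continuous (fun x => f x * g x).
Proof. by move=> cf cg x; apply: cvgM; [exact: cf|exact: cg]. Qed.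

Lemma cts_cst (c : R) : continuous (fun _ : T => c).
Proof. by move=> x; exact: cvg_cst. Qed.

Lemma cts_comp f (h : R -> R) : continuous f -> continuous h ->
  continuous (fun x => h (f x)).
Proof. by move=> cf ch x; apply: continuous_comp; [exact: cf|exact: ch]. Qed.

Lemma cts_sqr f : continuous f -> continuous (fun x => f x ^+ 2).
Proof. by move=> cf; exact: ctsM. Qed.

Lemma cts_norm f : continuous f -> continuous (fun x => `|f x|).
Proof. by move=> cf; apply: cts_comp => // x; exact: norm_continuous. Qed.

Lemma cts_sum (I : Type) (r : seq I) (F : I -> T -> R) :
  (forall i, continuous (F i)) -> continuous (fun x => \sum_(i <- r) F i x).
Proof.
move=> cF; elim: r => [|i r IH].
  have -> : (fun x : T => \sum_(i <- [::]) F i x) = (fun=> 0).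
    by apply/funext => x; rewrite big_nil.
  exact: cts_cst.
have -> : (fun x : T => \sum_(i <- i :: r) F i x) =
          (fun x => F i x + \sum_(i <- r) F i x).
  by apply/funext => x; rewrite big_cons.
exact: ctsD.
Qed.

Lemma closed_le_cts f g : continuous f -> continuous g -> closed [set x | f x <= g x].
Proof.
move=> cf cg.
have -> : [set x | f x <= g x] = (fun x => g x - f x) @^-1` [set y | 0 <= y].
  by apply/seteqP; split => x /=; rewrite subr_ge0.
apply: preimage_closed; last exact: closed_ge.
by move=> x _; apply: ctsB.
Qed.

Lemma closed_eq_cts f g : continuous f -> continuous g -> closed [set x | f x = g x].
Proof.
move=> cf cg.
have -> : [set x | f x = g x] = [set x | f x <= g x] `&` [set x | g x <= f x].
  apply/seteqP; split => x /= => [->//|[h1 h2]].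
  by apply/eqP; rewrite eq_le h1.
by apply: closedI; apply: closed_le_cts.
Qed.

Lemma closed_forall (I : Type) (A : I -> set T) :
  (forall i, closed (A i)) -> closed [set x | forall i, A i x].
Proof.
move=> cA; have -> : [set x | forall i, A i x] = \bigcap_(i in setT) A i.
  by apply/seteqP; split => x /= h i; [move=> _; exact: h|exact: h].
exact: closed_bigI.
Qed.

Lemma closed_imp (P : Prop) (A : set T) : closed A -> closed [set x | P -> A x].
Proof.
move=> cA; have [p|np] := pselect P.
  suff -> : [set x | P -> A x] = A by [].
  by apply/seteqP; split => x /= h; [exact: h|move=> _].
have -> : [set x | P -> A x] = setT.
  by apply/seteqP; split => x //= _ /np.
exact: closedT.
Qed.

End ContinuousReal.

Section Product.
Variable R : realType.

(** The topology of pointwise convergence, used for matrices (finite index set) and for whole curves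
    (uncountable index set) alike. *)
Definition pw (I : choiceType) : topologicalType := prod_topology (fun _ : I => R).

Lemma cts_proj (I : choiceType) (i : I) : continuous (fun f : pw I => f i : R).
Proof. exact: (@proj_continuous I (fun _ => R) i). Qed.

(** By Tychonoff: the bounds [B] make [A] a closed subset of a product of segments. *)
Lemma product_EVT_max (I : choiceType) (A : set (pw I)) (B : I -> R)
    (phi : pw I -> R) :
  closed A -> A !=set0 -> (forall f, A f -> forall i, `|f i| <= B i) ->
  continuous phi -> exists2 f, A f & forall g, A g -> phi g <= phi f.
Proof.
move=> cA A0 AB cphi.
have cptA : compact A.
  apply: (subclosed_compact cA (@tychonoff I (fun _ => R)
    (fun i => `[- B i, B i]%classic) (fun i => @segment_compact R _ _))).
  by move=> f Af i /=; rewrite in_itv/= -ler_norml; exact: AB.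
have [f /set_mem Af maxf] := compact_EVT_max A0 cptA (continuous_subspaceT cphi).
by exists f => // g Ag; apply: maxf; exact: mem_set.
Qed.

Lemma fin_closed (I : finType) (A : set (pw I)) :
  (forall x : I -> R, (forall e : R, 0 < e ->
     exists2 w : I -> R, A w & forall i, `|w i - x i| < e) -> A x) ->
  closed A.
Proof.
move=> H x clx; apply: H => e e0.
have [|w [Aw wx]] := clx [set w : pw I | forall i, `|w i - x i| < e].
  apply: (@filter_forall _ _ (fun i w => `|w i - x i| < e) (nbhs x) _) => i.
  have := @cts_proj I i x; move/cvgrPdist_lt => /(_ e e0).
  by apply: filterS => w; rewrite distrC.
by exists w.
Qed.

(** The first-order condition at a minimum: if [P < 0], then [t = - P / (Q - P + 1)] lies in []0,
    1[] and makes [2 * P + t * Q] negative. *)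
Lemma quad_ge0 (P Q : R) : 0 <= Q ->
  (forall t, 0 < t < 1 -> 0 <= 2 * t * P + t ^+ 2 * Q) -> 0 <= P.
Proof.
move=> Q0 H; rewrite leNgt; apply/negP => P0.
have D0 : 0 < Q - P + 1 by lra.
pose t := - P / (Q - P + 1).
have tD : t * (Q - P + 1) = - P by rewrite /t divfK// gt_eqF.
have t0 : 0 < t by rewrite /t divr_gt0// oppr_gt0.
have t1 : t < 1 by rewrite /t ltr_pdivrMr// mul1r; lra.
have := H t; rewrite t0 t1 => /(_ isT).
have -> : 2 * t * P + t ^+ 2 * Q = t * (2 * P + t * Q) by ring.
rewrite leNgt pmulr_rlt0// => /negP; apply.
by nra.
Qed.

(** [f] is [w0 - x] with [w0] the point of the cone nearest to [x]. Minimality against [w0 + t * w]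
    gives [f . w >= 0], against [(1 - t) * w0] it gives [f . w0 <= 0]; hence
    [f . x = f . w0 - |f|^2 < 0]. *)
Lemma cone_separation (I : finType) (A : set (I -> R)) (x : I -> R) :
  (forall x : I -> R, (forall e : R, 0 < e ->
     exists2 w : I -> R, A w & forall i, `|w i - x i| < e) -> A x) ->
  A (fun=> 0) ->
  (forall v w, A v -> A w -> A (fun i => v i + w i)) ->
  (forall l v, 0 < l -> A v -> A (fun i => l * v i)) ->
  ~ A x ->
  exists f : I -> R, (forall w, A w -> 0 <= \sum_i f i * w i) /\
    \sum_i f i * x i < 0.
Proof.
move=> cA A0 AD AZ nAx.
pose d (w : pw I) : R := \sum_i (w i - x i) ^+ 2.
pose S := \sum_i x i ^+ 2.
have cd : continuous d.
  by apply: cts_sum => i; apply: cts_sqr; apply: ctsB; [exact: cts_proj|exact: cts_cst].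
(* [S] is the squared distance from [x] to the origin: the cut keeps the origin, makes the set
   bounded and does not change the minimum. *)
pose A' : set (pw I) := [set w | A w] `&` [set w | d w <= S].
have cA' : closed A'.
  apply: closedI; first exact: fin_closed.
  by apply: closed_le_cts => //; exact: cts_cst.
have A'0 : A' (fun=> 0).
  split=> //=; rewrite /d /S; apply: ler_sum => i _.
  by rewrite sub0r sqrrN.
have [|||w0 [/= Aw0 dw0] minw0] :=
  @product_EVT_max I A' (fun i => `|x i| + (S + 1)) (fun w => - d w) cA'.
- by exists (fun=> 0).
- move=> w [_ /= dw] i.
  have h : (w i - x i) ^+ 2 <= S.
    apply: le_trans dw; rewrite /d (bigD1 i)//= lerDl.
    by apply: sumr_ge0 => j _; exact: sqr_ge0.
  have -> : w i = (w i - x i) + x i by rewrite subrK.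
  apply: (le_trans (ler_normD _ _)); rewrite addrC lerD2l.
  move: h; rewrite -real_normK ?num_real// => h.
  have := normr_ge0 (w i - x i); nra.
- exact: ctsN.
have {}minw0 w : A w -> d w0 <= d w.
  move=> Aw; have [dw|dw] := leP (d w) S; last exact: le_trans dw0 (ltW dw).
  by rewrite -lerN2; apply: minw0; split.
pose f i := w0 i - x i.
have expand (t : R) (u : I -> R) :
    d (fun i => w0 i + t * u i) = d w0 + (2 * t * (\sum_i f i * u i) + t ^+ 2 * (\sum_i u i ^+ 2)).
  rewrite /d !mulr_sumr -!big_split/=; apply: eq_bigr => i _; rewrite /f; ring.
have Q0 (u : I -> R) : 0 <= \sum_i u i ^+ 2 by apply: sumr_ge0 => i _; exact: sqr_ge0.
exists f; split.
  move=> w Aw; apply: (quad_ge0 (Q0 w)) => t /andP[t0 t1].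
  rewrite -(lerD2l (d w0)) addr0 -expand; apply: minw0.
  by apply: AD => //; exact: AZ.
have fw0 : \sum_i f i * w0 i <= 0.
  rewrite -oppr_ge0; apply: (quad_ge0 (Q0 w0)) => t /andP[t0 t1].
  have -> : 2 * t * - (\sum_i f i * w0 i) = 2 * (- t) * (\sum_i f i * w0 i) by ring.
  rewrite -(sqrrN t) -(lerD2l (d w0)) addr0 -expand; apply: minw0.
  have -> : (fun i => w0 i + - t * w0 i) = (fun i => (1 - t) * w0 i).
    by apply/funext => i; ring.
  by apply: AZ => //; rewrite subr_gt0.
have -> : \sum_i f i * x i = \sum_i f i * w0 i - \sum_i f i ^+ 2.
  by rewrite -sumrB; apply: eq_bigr => i _; rewrite /f; ring.
suff : 0 < \sum_i f i ^+ 2 by lra.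
rewrite lt_neqAle Q0 andbT eq_sym; apply/eqP => /psumr_eq0P H.
apply: nAx; suff -> : x = w0 by [].
apply/funext => i; apply/eqP; rewrite eq_sym -subr_eq0 -sqrf_eq0; apply/eqP.
by apply: H => // j _; exact: sqr_ge0.
Qed.
End Product.

(** * The cone inside the Killing cone *)

Section TwoByTwo.
Variable R : realType.
Notation M := 'M[R]_2.

Lemma sum2 (F : 'I_2 -> R) : \sum_i F i = F 0 + F 1.
Proof. by rewrite !big_ord_recl big_ord0 addr0; congr (_ + F _); apply/val_inj. Qed.

Lemma ord2P (i : 'I_2) : i = 0 \/ i = 1.
Proof. by case: i => [[|[|//]] ?]; [left|right]; apply/val_inj. Qed.

Lemma mul2E (A B : M) i j : (A *m B) i j = A i 0 * B 0 j + A i 1 * B 1 j.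
Proof. by rewrite mxE sum2. Qed.

Lemma tr2E (A : M) : \tr A = A 0 0 + A 1 1.
Proof. by rewrite /mxtrace sum2. Qed.

Lemma det2E (A : M) : \det A = A 0 0 * A 1 1 - A 0 1 * A 1 0.
Proof.
rewrite (expand_det_row _ 0) sum2 /cofactor !det_mx11 !mxE/=.
have -> : lift 0 0 = 1 :> 'I_2 by apply/val_inj.
have -> : lift 1 0 = 0 :> 'I_2 by apply/val_inj.
by rewrite /= !expr0 !expr1; ring.
Qed.

Lemma mx2P (A B : M) : A 0 0 = B 0 0 -> A 0 1 = B 0 1 -> A 1 0 = B 1 0 ->
  A 1 1 = B 1 1 -> A = B.
Proof.
move=> h1 h2 h3 h4; apply/matrixP => i j.
by have [->|->] := ord2P i; have [->|->] := ord2P j.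
Qed.

Lemma killingE (v : M) : in_sl2 v -> killing v v = 8 * (v 0 0 ^+ 2 + v 0 1 * v 1 0).
Proof.
rewrite /in_sl2 tr2E => tr0; have v11 : v 1 1 = - v 0 0 by lra.
rewrite /killing /slcoordH /slcoordE /slcoordF /ad.
by rewrite !(sum2, mxE)/= v11; ring.
Qed.

(** Adding a small [t] to both off-diagonal entries, with [t * (v 0 1 + v 1 0) >= 0], raises the
    quadratic form by at least [t ^+ 2], and it must still be nonpositive. *)
Lemma int_killing_cone_lt0 (v : M) : in_int_killing_cone v ->
  v 0 0 ^+ 2 + v 0 1 * v 1 0 < 0.
Proof.
move=> [trv [e e0 H]].
have [t [t0 te tb]] : exists t : R, [/\ t != 0, `|t| < e & 0 <= t * (v 0 1 + v 1 0)].
  have e2 : 0 < e / 2 by exact: divr_gt0.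
  have [b|b] := leP 0 (v 0 1 + v 1 0).
    exists (e / 2); split; [by rewrite gt_eqF|by rewrite gtr0_norm//; lra|].
    by rewrite mulr_ge0// ltW.
  exists (- (e / 2)); split; [by rewrite oppr_eq0 gt_eqF|by rewrite normrN gtr0_norm//; lra|].
  by apply: mulr_le0; [rewrite oppr_le0; exact: ltW|exact: ltW].
pose w : M := \matrix_(i, j) (v i j + (if i == j then 0 else t)).
have trw : in_sl2 w by move: trv; rewrite /in_sl2 !tr2E !mxE/= !addr0.
have /(H w trw) : mx_close v w e.
  by move=> i j; rewrite !mxE addrAC subrr add0r; case: ifP => _; rewrite ?normr0.
rewrite killingE// !mxE/= => K; have : 0 < t ^+ 2 by rewrite exprn_even_gt0.
nra.
Qed.
End TwoByTwo.

Section Cone.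
Variables (R : realType) (C : set 'M[R]_2).
Notation M := 'M[R]_2.
Hypothesis coneC : closed_convex_acute_cone C.
Hypothesis intC : forall v, C v -> v != 0 -> in_int_killing_cone v.

Definition mx_of_fun (w : 'I_2 * 'I_2 -> R) : M := \matrix_(i, j) w (i, j).

Lemma cone_tr v : C v -> v 1 1 = - v 0 0.
Proof.
have [[sub _] _ _ _ _] := coneC; move=> /sub; rewrite /in_sl2 /= tr2E => h; lra.
Qed.

Lemma cone_neq v : C v -> v != 0 -> v 1 0 - v 0 1 != 0.
Proof.
move=> Cv v0; have := int_killing_cone_lt0 (intC Cv v0).
by apply: contraTneq => h; rewrite -leNgt; nra.
Qed.

(** If two vectors of [C] had opposite signs, a positive combination would lie on the plane
    [v 1 0 = v 0 1], which meets [C] only in zero; then [- v] would belong to [C], against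
    acuteness. *)
Lemma cone_sign : exists2 eps : R, eps = 1 \/ eps = -1 &
  forall v, C v -> v != 0 -> 0 < eps * (v 1 0 - v 0 1).
Proof.
have [[_ _] _ CD CZ CN] := coneC.
have [[v [Cv v0 vp]]|H] := pselect (exists v, [/\ C v, v != 0 & 0 < v 1 0 - v 0 1]).
  exists 1; [by left|]; move=> w Cw w0; rewrite mul1r ltNge; apply/negP => wn.
  have wn' : w 1 0 - w 0 1 < 0 by rewrite lt_neqAle wn cone_neq.
  pose a := v 1 0 - v 0 1; pose b := - (w 1 0 - w 0 1).
  have b0 : 0 < b by rewrite oppr_gt0.
  have Cu : C (b *: v + a *: w) by apply: CD; exact: CZ.
  have [u0|u0] := eqVneq (b *: v + a *: w) 0; last first.
    by have := cone_neq Cu u0; rewrite !mxE /a /b => /eqP; apply; ring.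
  have CNv : C (- v).
    have -> : - v = (b^-1 * a) *: w.
      move/eqP: u0; rewrite addrC addr_eq0 => /eqP u0.
      by rewrite -scalerA u0 scalerN scalerA mulVf ?gt_eqF// scale1r.
    by apply: CZ => //; rewrite mulr_gt0 ?invr_gt0.
  by move: v0; rewrite (CN _ Cv CNv) eqxx.
exists (-1); [by right|]; move=> v Cv v0; rewrite mulN1r oppr_gt0 lt_neqAle cone_neq//=.
by rewrite leNgt; apply/negP => vp; apply: H; exists v.
Qed.

(** [al] is [alpha] oriented by [eps], and the last inequality is [|beta| <= (1 - delta) * al]
    squared. On the compact slice [al = 1] the function [|beta|^2] attains a maximum [m < 1];
    homogeneity extends the bound to [C]. *)
Lemma cone_gap : exists eps delta : R, [/\ eps = 1 \/ eps = -1, 0 < delta < 1 &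
  forall v, C v -> let al := eps * (v 1 0 - v 0 1) / 2 in
    [/\ 0 <= al, v != 0 -> 0 < al &
     v 0 0 ^+ 2 + ((v 0 1 + v 1 0) / 2) ^+ 2 <= ((1 - delta) * al) ^+ 2]].
Proof.
have [eps epsE pos] := cone_sign.
have eps2 : eps ^+ 2 = 1 by case: epsE => ->; rewrite ?sqrrN expr1n.
have [[_ clC] C0 CD CZ CN] := coneC.
pose al (w : pw R ('I_2 * 'I_2)%type) := eps * (w (1, 0) - w (0, 1)) / 2.
pose bt (w : pw R ('I_2 * 'I_2)%type) := w (0, 0) ^+ 2 + ((w (0, 1) + w (1, 0)) / 2) ^+ 2.
pose A : set (pw R ('I_2 * 'I_2)%type) := [set w | C (mx_of_fun w)] `&` [set w | al w = 1].
have cal : continuous al.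
  apply: ctsM; last exact: cts_cst.
  by apply: ctsM; [exact: cts_cst|apply: ctsB; exact: cts_proj].
have cbt : continuous bt.
  apply: ctsD; apply: cts_sqr; first exact: cts_proj.
  by apply: ctsM; [apply: ctsD; exact: cts_proj|exact: cts_cst].
have clA : closed A.
  apply: closedI; last by apply: closed_eq_cts => //; exact: cts_cst.
  apply: fin_closed => x H; apply: clC => e e0.
  have [w Cw wx] := H e e0; exists (mx_of_fun w) => // i j.
  by rewrite !mxE.
have Anz w : A w -> mx_of_fun w != 0.
  move=> [_ /=]; apply: contra_eq_neq => /eqP/eqP w0.
  have h i j : w (i, j) = 0.
    by have := congr1 (fun X : M => X i j) w0; rewrite !mxE.
  by rewrite /al !h subrr mulr0 mul0r eq_sym oner_eq0.
have Abt w : A w -> bt w < 1.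
  move=> /[dup] /Anz w0 [Cw /= alw].
  have := int_killing_cone_lt0 (intC Cw w0); rewrite !mxE.
  have : al w ^+ 2 = ((w (1, 0) - w (0, 1)) / 2) ^+ 2.
    by rewrite /al -mulrA exprMn eps2 mul1r.
  rewrite alw expr1n /bt; lra.
(* An empty slice means that [C] contains only zero, and then any [delta] will do. *)
have [A0|A0] := pselect (A !=set0); last first.
  exists eps, (1 / 2); split => //; first by apply/andP; split; lra.
  move=> v Cv; have [v0|v0] := eqVneq v 0.
    by rewrite v0 !mxE; split=> //; nra.
  exfalso; apply: A0; pose a := eps * (v 1 0 - v 0 1) / 2.
  have a0 : 0 < a by rewrite /a divr_gt0// pos.
  exists (fun ij => a^-1 * v ij.1 ij.2); split => /=.
    have -> : mx_of_fun (fun ij => a^-1 * v ij.1 ij.2) = a^-1 *: v.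
      by apply/matrixP => i j; rewrite !mxE.
    by apply: CZ => //; rewrite invr_gt0.
  rewrite /al/= -mulrBr mulrCA -mulrA -/a mulVf// gt_eqF//.
have [||w0 Aw0 maxw0] := @product_EVT_max R _ A (fun=> 2) bt clA A0.
- move=> w /[dup] /Abt + [Cw /= alw] [i j].
  have : al w ^+ 2 = ((w (1, 0) - w (0, 1)) / 2) ^+ 2.
    by rewrite /al -mulrA exprMn eps2 mul1r.
  rewrite alw expr1n /bt => a1 btw.
  have := cone_tr Cw; rewrite !mxE => w11.
  have b2 (x : R) : x ^+ 2 <= 4 -> `|x| <= 2.
    move=> h; rewrite ler_norml; apply/andP; split; nra.
  have := sqr_ge0 (w (0, 0)); have := sqr_ge0 ((w (0, 1) + w (1, 0)) / 2) => h1 h2.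
  have [->|->] := ord2P i; have [->|->] := ord2P j; apply: b2; rewrite ?w11; nra.
- exact: cbt.
pose m := bt w0; have m1 : m < 1 by exact: Abt.
have m0 : 0 <= m by rewrite /m /bt addr_ge0// sqr_ge0.
(* With this choice [1 - delta = (1 + m) / 2], whose square is at least [m]. *)
exists eps, ((1 - m) / 2); split => //; first by apply/andP; split; lra.
move=> v Cv; have [->|v0] := eqVneq v 0.
  by rewrite !mxE; split=> //; nra.
set a := eps * _ / 2; have a0 : 0 < a by rewrite /a divr_gt0// pos.
split => //; first exact: ltW.
have /maxw0 : A (fun ij => a^-1 * v ij.1 ij.2).
  split => /=.
    have -> : mx_of_fun (fun ij => a^-1 * v ij.1 ij.2) = a^-1 *: v.
      by apply/matrixP => i j; rewrite !mxE.
    by apply: CZ => //; rewrite invr_gt0.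
  by rewrite /al/= -mulrBr mulrCA -mulrA -/a mulVf// gt_eqF.
rewrite -/m /bt/= => h.
have : v 0 0 ^+ 2 + ((v 0 1 + v 1 0) / 2) ^+ 2 <= m * a ^+ 2.
  have -> : v 0 0 ^+ 2 + ((v 0 1 + v 1 0) / 2) ^+ 2 =
    ((a^-1 * v 0 0) ^+ 2 + ((a^-1 * v 0 1 + a^-1 * v 1 0) / 2) ^+ 2) * a ^+ 2.
    by field; rewrite gt_eqF.
  by apply: ler_wpM2r => //; exact: sqr_ge0.
move/le_trans; apply; rewrite [leRHS]exprMn; apply: ler_wpM2r; first exact: sqr_ge0.
by nra.
Qed.

End Cone.

(** * The hypograph of the anti-norm *)

Section Hypograph.
Variables (R : realType) (C : set 'M[R]_2) (nu : 'M[R]_2 -> \bar R).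
Notation M := 'M[R]_2.
Hypothesis coneC : closed_convex_acute_cone C.
Hypothesis anti : anti_norm C nu.
Hypothesis usc : upper_semicontinuous nu.

Definition mxdot (f v : M) : R :=
  f 0 0 * v 0 0 + f 0 1 * v 0 1 + f 1 0 * v 1 0 + f 1 1 * v 1 1.

(** The dual cone of the hypograph: [(f, q)] encodes [q * s <= mxdot f v] for all [v] in [C] and
    [s <= nu v]. *)
Definition dual (f : M) (q : R) : Prop :=
  0 <= q /\ forall v, C v -> q * fine (nu v) <= mxdot f v.

Lemma nu_fin v : C v -> nu v = (fine (nu v))%:E.
Proof.
have [lty pos _ _ _] := anti; move=> Cv.
rewrite fineK// ge0_fin_numE ?lty//; exact: pos.
Qed.

Lemma nu0 : nu 0 = 0%E.
Proof.
have [_ C0 _ _ _] := coneC; have [_ _ _ nuZ _] := anti.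
have := nuZ 2 0 (ltr0Sn _ 1); rewrite scaler0 (nu_fin C0) -EFinM => -[h].
by congr (_%:E); lra.
Qed.

(** The coordinates [Some ij] hold the vector and [None] the height, which makes the hypograph a
    cone in a finite product of lines. *)
Definition hypo (u : option ('I_2 * 'I_2) -> R) : Prop :=
  C (mx_of_fun (fun ij => u (Some ij))) /\
  ((u None)%:E <= nu (mx_of_fun (fun ij => u (Some ij))))%E.

(** Upper semicontinuity keeps [nu] below an intermediate level [a] near [v], whereas nearby points
    of the hypograph would have height above [a]. *)
Lemma hypo_closed (x : option ('I_2 * 'I_2) -> R) :
  (forall e : R, 0 < e -> exists2 w, hypo w & forall i, `|w i - x i| < e) -> hypo x.
Proof.
move=> H; have [[_ clC] _ _ _ _] := coneC.
set v := mx_of_fun (fun ij => x (Some ij)).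
split.
  apply: clC => e e0; have [w [Cw _] wx] := H e e0.
  by exists (mx_of_fun (fun ij => w (Some ij))) => // i j; rewrite !mxE.
rewrite -/v leNgt; apply/negP => lt.
have [a nua ax] : exists2 a : R, (nu v < a%:E)%E & a < x None.
  move: lt; case: (nu v) => [r| |] //.
    rewrite lte_fin => rx; exists ((r + x None) / 2); rewrite ?lte_fin; lra.
  by move=> _; exists (x None - 1); rewrite ?ltNyr//; lra.
have [e e0 He] := usc nua.
have e'0 : 0 < Num.min e (x None - a) by rewrite lt_min e0 subr_gt0.
have [w [Cw nuw] wx] := H _ e'0.
have /He : mx_close v (mx_of_fun (fun ij => w (Some ij))) e.
  move=> i j; rewrite !mxE; apply: lt_le_trans (wx _) _.
  by rewrite ge_min lexx.
move=> /(le_lt_trans nuw); rewrite lte_fin.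
have := lt_le_trans (wx None) (_ : _ <= x None - a).
rewrite ge_min lexx orbT => /(_ isT); rewrite ltr_norml => /andP[h1 _] h2.
by clear lt nua nuw; lra.
Qed.

(** Otherwise some [F] separates [(v, s)] from the hypograph. Testing [F] on [(0, -1)] gives
    [F None <= 0], so [F] is a dual pair that violates the assumption. *)
Lemma nu_bipolar (v : M) (s : R) :
  (forall f q, dual f q -> q * s <= mxdot f v) -> C v /\ (s%:E <= nu v)%E.
Proof.
move=> H; have [[_ _] C0 CD CZ _] := coneC; have [_ pos _ nuZ nuD] := anti.
pose x (o : option ('I_2 * 'I_2)) := if o is Some ij then v ij.1 ij.2 else s.
have xv : mx_of_fun (fun ij => x (Some ij)) = v by apply/matrixP => i j; rewrite mxE.
suff : hypo x by rewrite /hypo xv.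
apply: contrapT => nx.
have h0 : mx_of_fun (fun=> 0) = 0 :> M by apply/matrixP => i j; rewrite !mxE.
have [|||F [Fge Flt]] := @cone_separation R _ hypo x hypo_closed _ _ _ nx.
- by rewrite /hypo h0 nu0.
- move=> u w [Cu nuu] [Cw nuw]; rewrite /hypo.
  have -> : mx_of_fun (fun ij => u (Some ij) + w (Some ij)) =
    mx_of_fun (fun ij => u (Some ij)) + mx_of_fun (fun ij => w (Some ij)).
    by apply/matrixP => i j; rewrite !mxE.
  split; first exact: CD.
  by apply: le_trans (nuD _ _); rewrite EFinD; exact: leeD.
- move=> l u l0 [Cu nuu]; rewrite /hypo.
  have -> : mx_of_fun (fun ij => l * u (Some ij)) = l *: mx_of_fun (fun ij => u (Some ij)).
    by apply/matrixP => i j; rewrite !mxE.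
  split; first exact: CZ.
  by rewrite nuZ// EFinM lee_pmul2l.
have sumE (u : option ('I_2 * 'I_2) -> R) :
    \sum_i F i * u i = mxdot (mx_of_fun (fun ij => F (Some ij))) (mx_of_fun (fun ij => u (Some ij))) + F None * u None.
  rewrite (bigD1 None)//= [LHS]addrC; congr (_ + _).
  transitivity (\sum_ij F (Some ij) * u (Some ij)).
    rewrite (reindex_omap Some id)/=; first by apply: eq_bigl => ij; rewrite eqxx.
    by case.
  transitivity (\sum_i \sum_j F (Some (i, j)) * u (Some (i, j))).
    by rewrite pair_bigA/=; apply: eq_bigr => -[].
  by rewrite !sum2 /mxdot !mxE; ring.
have q0 : F None <= 0.
  have /Fge : hypo (fun o => if o is Some _ then 0 else -1).
    by rewrite /hypo h0 nu0 lee_fin; split=> //; lra.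
  by rewrite sumE /mxdot !mxE/=; lra.
have /H : dual (mx_of_fun (fun ij => F (Some ij))) (- F None).
  split; first by rewrite oppr_ge0.
  move=> w Cw; pose u (o : option ('I_2 * 'I_2)) := if o is Some ij then w ij.1 ij.2 else fine (nu w).
  have uw : mx_of_fun (fun ij => u (Some ij)) = w by apply/matrixP => i j; rewrite mxE.
  have := Fge u; rewrite sumE uw/= => h.
  have : hypo u by rewrite /hypo uw; split=> //=; rewrite -nu_fin.
  by move=> /h; lra.
by move: Flt; rewrite sumE xv /=; lra.
Qed.

Lemma mxdot_le (f v : M) (a : R) : (forall i j, `|v i j| <= a) ->
  `|mxdot f v| <= (`|f 0 0| + `|f 0 1| + `|f 1 0| + `|f 1 1|) * a.
Proof.
move=> va; rewrite /mxdot !mulrDl.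
do 3 (apply: (le_trans (ler_normD _ _)); apply: lerD; last by rewrite normrM ler_wpM2l).
by rewrite normrM ler_wpM2l.
Qed.

(** Take a dual pair with [q > 0] and divide by [q]. If there were none, the bipolar property would
    put [(0, 1)] into the hypograph, against [nu 0 = 0]. *)
Lemma nu_majorant : exists f : M, forall v, C v -> fine (nu v) <= mxdot f v.
Proof.
have [[f [q [fq fq0]]]|H] := pselect (exists f q, dual f q /\ mxdot f 0 < q); last first.
  have : C 0 /\ ((1 : R)%:E <= nu 0)%E.
    apply: nu_bipolar => f q fq; rewrite mulr1 leNgt; apply/negP => h.
    by apply: H; exists f, q.
  by rewrite nu0 lee_fin => -[_]; rewrite leNgt ltr01.
have q0 : 0 < q by move: fq0; rewrite /mxdot !mxE !mulr0 !addr0.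
exists (q^-1 *: f) => v Cv.
have -> : mxdot (q^-1 *: f) v = q^-1 * mxdot f v by rewrite /mxdot !mxE; ring.
by rewrite ler_pdivlMl//; apply: fq.2.
Qed.
End Hypograph.

(** * Lipschitz functions on an interval *)

Section LipschitzOn.
Variables (R : realType) (a b : R).
Implicit Types f g : R -> R.

Definition lip f := exists k : R, forall x y, a <= x <= b -> a <= y <= b ->
  `|f x - f y| <= k * `|x - y|.

Lemma lip_pos f : lip f -> exists k : R, 0 <= k /\ forall x y, a <= x <= b ->
  a <= y <= b -> `|f x - f y| <= k * `|x - y|.
Proof.
move=> [k kf]; exists `|k|; split=> // x y xab yab.
by apply: (le_trans (kf _ _ xab yab)); rewrite ler_wpM2r// ler_norm.
Qed.

Lemma lip_bounded f : lip f -> exists B : R, 0 <= B /\ forall x, a <= x <= b -> `|f x| <= B.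
Proof.
move=> /lip_pos[k [k0 kf]].
exists (`|f a| + k * `|b - a|); split; first by rewrite addr_ge0// mulr_ge0.
move=> x /[dup] xab /andP[ax xb]; have -> : f x = f a + (f x - f a) by ring.
have aab : a <= a <= b by rewrite lexx (le_trans ax xb).
apply: (le_trans (ler_normD _ _)); rewrite lerD2l.
apply: (le_trans (kf _ _ xab aab)); rewrite ler_wpM2l//.
by rewrite !ger0_norm ?subr_ge0 ?(le_trans ax xb)// lerD2r.
Qed.

Lemma lip_cst c : lip (fun=> c).
Proof. by exists 0 => x y _ _; rewrite subrr normr0 mul0r. Qed.

Lemma lipD f g : lip f -> lip g -> lip (fun x => f x + g x).
Proof.
move=> [k kf] [l lg]; exists (k + l) => x y xab yab.
have -> : f x + g x - (f y + g y) = (f x - f y) + (g x - g y) by ring.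
by apply: (le_trans (ler_normD _ _)); rewrite mulrDl lerD ?kf ?lg.
Qed.

Lemma lipM f g : lip f -> lip g -> lip (fun x => f x * g x).
Proof.
move=> lf lg; have [B [B0 fB]] := lip_bounded lf; have [D [D0 gD]] := lip_bounded lg.
have [k [k0 kf]] := lip_pos lf; have [l [l0 {}lg]] := lip_pos lg.
exists (k * D + B * l) => x y xab yab.
have -> : f x * g x - f y * g y = (f x - f y) * g x + f y * (g x - g y) by ring.
apply: (le_trans (ler_normD _ _)); rewrite [leRHS]mulrDl !normrM lerD//.
  by rewrite mulrAC ler_pM ?kf ?gD.
by rewrite -mulrA ler_pM ?fB ?lg.
Qed.

Lemma lipZ c f : lip f -> lip (fun x => c * f x).
Proof. by move=> lf; apply: lipM => //; exact: lip_cst. Qed.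

Lemma lipN f : lip f -> lip (fun x => - f x).
Proof.
move=> [k kf]; exists k => x y xab yab.
by rewrite -opprD normrN; exact: kf.
Qed.

Lemma lipB f g : lip f -> lip g -> lip (fun x => f x - g x).
Proof. by move=> lf lg; apply: lipD => //; exact: lipN. Qed.

Lemma lip_sqr f : lip f -> lip (fun x => f x ^+ 2).
Proof. by move=> lf; apply: lipM. Qed.

Lemma lip_expR f : lip f -> lip (fun x => expR (f x)).
Proof.
move=> lf; have [B [B0 fB]] := lip_bounded lf; have [k [k0 kf]] := lip_pos lf.
have exp_le (u v : R) : u <= v -> v <= B -> `|expR u - expR v| <= expR B * `|u - v|.
  move=> uv vB; rewrite distrC (distrC u) !ger0_norm ?subr_ge0 ?ler_expR//.
  apply: (@le_trans _ _ (expR v * (v - u))); last first.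
    by rewrite ler_wpM2r ?subr_ge0// ler_expR.
  have -> : expR u = expR v * expR (u - v) by rewrite -expRD; congr expR; ring.
  have := expR_ge1Dx (u - v); have := expR_gt0 v; nra.
exists (expR B * k) => x y xab yab.
have fx := le_trans (ler_norm _) (fB _ xab); have fy := le_trans (ler_norm _) (fB _ yab).
apply: (@le_trans _ _ (expR B * `|f x - f y|)); last first.
  by rewrite -mulrA ler_wpM2l ?kf// expR_ge0.
have [xy|/ltW xy] := leP (f x) (f y); first exact: exp_le.
by rewrite distrC (distrC (f x)); exact: exp_le.
Qed.

End LipschitzOn.

(** * From local estimates to derivatives and Lipschitz bounds *)

Section Local.
Variable R : realType.

Lemma is_derive_quot (F : R -> R) (x l : R) : is_derive x 1 F l ->
  forall e : R, 0 < e -> exists2 d : R, 0 < d &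
    forall h, `|h| < d -> `|F (x + h) - F x - l * h| <= e * `|h|.
Proof.
move=> [dF dFl] e e0.
have : h^-1 *: (F (h *: 1 + x) - F x) @[h --> 0^'] --> l by rewrite -dFl; exact: dF.
move=> /cvgrPdist_le/(_ e e0); rewrite /dnbhs /within/=.
move=> /nbhs_ballP[d /= d0 H]; exists d => // h hd.
have [->|h0] := eqVneq h 0; first by rewrite addr0 subrr mulr0 subrr normr0 mulr0.
have := H h; rewrite /ball/= sub0r normrN => /(_ hd h0).
rewrite /GRing.scale/= mulr1 (addrC h) => q.
have -> : F (x + h) - F x - l * h = - (l - h^-1 * (F (x + h) - F x)) * h.
  by field.
by rewrite normrM normrN ler_wpM2r.
Qed.

(** A quadratic error disappears in the derivative; this turns the integrated differential inclusion
    back into a pointwise one. *)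
Lemma is_derive_ge0 (F : R -> R) (x l K d : R) : is_derive x 1 F l -> 0 < d ->
  (forall h, 0 < h < d -> - K * h ^+ 2 <= F (x + h) - F x) -> 0 <= l.
Proof.
move=> dF d0 H; rewrite leNgt; apply/negP => l0.
have [|d' d'0 Hd'] := is_derive_quot dF (e := - l / 2); first by lra.
pose K' := `|K| + 1; have K'0 : 0 < K' by rewrite ltr_wpDl.
(* Small enough for both radii and for [K' * h ^+ 2 < - l * h / 2]. *)
pose h := Num.min (Num.min d d') (- l / (2 * K')) / 2.
have m0 : 0 < Num.min (Num.min d d') (- l / (2 * K')).
  by rewrite !lt_min d0 d'0/= divr_gt0 ?oppr_gt0// mulr_gt0.
have h0 : 0 < h by rewrite divr_gt0.
have hm : h < Num.min (Num.min d d') (- l / (2 * K')) by rewrite /h; lra.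
move: hm; rewrite !lt_min => /andP[/andP[hd hd'] hl].
have := H h; rewrite h0 hd => /(_ isT) h1.
have := Hd' h; rewrite gtr0_norm// => /(_ hd'); rewrite ler_norml => /andP[_ h2].
have h3 : K * h ^+ 2 <= K' * h ^+ 2.
  by rewrite ler_wpM2r ?sqr_ge0// /K' (le_trans (ler_norm _))// lerDl.
have h4 : h * (2 * K') < - l by rewrite -ltr_pdivlMr// mulr_gt0.
nra.
Qed.

(* Continuity induction: the pointwise local bound propagates from the left endpoint. *)
Lemma lip_of_local (f : R -> R) (a b K : R) : 0 <= K ->
  (forall t, a <= t <= b -> exists2 d : R, 0 < d &
     forall s, a <= s <= b -> `|s - t| < d -> `|f s - f t| <= K * `|s - t|) ->
  forall x y, a <= x <= b -> a <= y <= b -> `|f x - f y| <= K * `|x - y|.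
Proof.
move=> K0 H.
suff main x y : a <= x -> x <= y -> y <= b -> `|f x - f y| <= K * `|x - y|.
  move=> x y /andP[ax xb] /andP[ay yb]; have [xy|/ltW yx] := leP x y; first exact: main.
  by rewrite distrC (distrC x); exact: main.
move=> ax xy yb.
pose S := [set t | x <= t <= y /\ `|f x - f t| <= K * (t - x)].
have Sx : S x by rewrite /S/= lexx xy !subrr normr0 mulr0.
have Sub : ubound S y by move=> t [/andP[]].
have supS : has_sup S by split; [exists x|exists y].
pose c := sup S.
have Sle t : S t -> t <= c by apply: sup_upper_bound.
have xc : x <= c by exact: Sle.
have cy : c <= y by apply: ge_sup => //; exists x.
have [d d0 Hd] : exists2 d : R, 0 < d &
     forall s, a <= s <= b -> `|s - c| < d -> `|f s - f c| <= K * `|s - c|.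
  by apply: H; rewrite (le_trans ax xc) (le_trans cy yb).
have Sc : `|f x - f c| <= K * (c - x).
  have [t [/andP[xt ty] ft] tc] := sup_adherent d0 supS.
  have t_c : t <= c by apply: Sle; split=> //; rewrite xt.
  have /Hd : a <= t <= b by rewrite (le_trans ax xt) (le_trans ty yb).
  rewrite ler0_norm ?subr_le0// => /(_ _) h.
  have {}h : `|f t - f c| <= K * - (t - c) by apply: h; rewrite -/c in tc; lra.
  have -> : f x - f c = (f x - f t) + (f t - f c) by ring.
  by apply: (le_trans (ler_normD _ _)); move: ft h; lra.
have cyE : c = y.
  apply/eqP; rewrite eq_le cy leNgt; apply/negP => c_y.
  pose t := Num.min y (c + d / 2).
  have ct : c < t by rewrite /t lt_min c_y; lra.
  have ty : t <= y by rewrite /t ge_min lexx.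
  have td : t <= c + d / 2 by rewrite /t ge_min lexx orbT.
  have St : S t.
    split; first by rewrite ty andbT (le_trans xc (ltW ct)).
    have /Hd : a <= t <= b by rewrite (le_trans ty yb) andbT (le_trans (le_trans ax xc) (ltW ct)).
    rewrite gtr0_norm ?subr_gt0// => /(_ _) h.
    have {}h : `|f t - f c| <= K * (t - c) by apply: h; lra.
    have -> : f x - f t = (f x - f c) - (f t - f c) by ring.
    by apply: (le_trans (ler_normB _ _)); move: Sc h; lra.
  have : t <= c by exact: Sle.
  by rewrite leNgt ct.
by rewrite (distrC x) (ger0_norm (_ : 0 <= y - x)) ?subr_ge0// -cyE.
Qed.

(** The sine has slope one at zero. Thus a bound on the sine of a small phase difference bounds the
    difference itself. *)
Lemma sin_lower : exists2 d : R, 0 < d & forall h : R, `|h| < d -> `|h| <= 2 * `|sin h|.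
Proof.
have [|d d0 H] := is_derive_quot (is_derive_sin (0 : R)) (e := 1 / 2); first by lra.
exists d => // h /H; rewrite add0r sin0 cos0 subr0 mul1r => h1.
have := ler_normB (sin h) (sin h - h); rewrite opprB addrC subrK => h2.
lra.
Qed.
End Local.

(** * The phase of a point of the universal cover *)

Section Phase.
Variable R : realType.
Notation M := 'M[R]_2.

(** If [\det X = 1], this is minus the tangent of the angle from the first column to
    [z = (X 0 0 + X 1 1) + i (X 1 0 - X 0 1)]. *)
Definition mquot (X : M) : R :=
  (X 0 0 * X 0 1 + X 1 0 * X 1 1) / (X 0 0 ^+ 2 + X 1 0 ^+ 2 + 1).

(* The argument of z = (X00 + X11) + i (X10 - X01): the first column x satisfies
   Re (x^* z) = |x|^2 + 1 > 0, so the two arguments differ by an arctangent. *)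
Definition phase (X : M) (th : R) : R := th - atan (mquot X).

(** In polar form the determinant condition is [r1], which forces [r > 0]; the subtraction formulas
    reduce both identities to [r1] and [cs]. *)
Lemma phase_polar (X : M) (th : R) : in_G X th -> exists2 rho : R, 0 < rho &
  X 0 0 + X 1 1 = rho * cos (phase X th) /\ X 1 0 - X 0 1 = rho * sin (phase X th).
Proof.
rewrite /in_G det2E /angle_of => -[dt [aE cE]].
have : 0 <= Num.sqrt (X 0 0 ^+ 2 + X 1 0 ^+ 2) by exact: sqrtr_ge0.
set r := Num.sqrt _ in aE cE *; move=> r0.
set c := cos th in aE *; set s := sin th in cE *.
have cs : c ^+ 2 + s ^+ 2 = 1 by exact: cos2Dsin2.
have r1 : r * (c * X 1 1 - s * X 0 1) = 1 by rewrite -dt aE cE; ring.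
have {r0} r0 : 0 < r.
  rewrite lt_neqAle r0 andbT; apply/eqP => r00; move: r1; rewrite -r00 mul0r => /eqP.
  by rewrite eq_sym oner_eq0.
have n0 : 0 < X 0 0 ^+ 2 + X 1 0 ^+ 2 + 1 by rewrite ltr_wpDl// addr_ge0// sqr_ge0.
rewrite /phase cosB sinB -/c -/s.
set u := mquot X; set k := cos (atan u).
have k0 : 0 < k by rewrite /k cos_atan invr_gt0 sqrtr_gt0 ltr_wpDr// sqr_ge0.
have -> : sin (atan u) = u * k.
  by rewrite -{2}(atanK u) /tan -/k divfK// gt_eqF.
(* The modulus of [z]: its component along the first column is [(r ^+ 2 + 1) / r], which is also
   [rho * k]. *)
exists ((X 0 0 ^+ 2 + X 1 0 ^+ 2 + 1) / (r * k)); first by rewrite divr_gt0// mulr_gt0.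
have uE : u * (X 0 0 ^+ 2 + X 1 0 ^+ 2 + 1) = X 0 0 * X 0 1 + X 1 0 * X 1 1.
  by rewrite /u /mquot divfK// gt_eqF.
have rk : r * k != 0 by rewrite gt_eqF// mulr_gt0.
have rn : r != 0 by rewrite gt_eqF.
have kn : k != 0 by rewrite gt_eqF.
set n := X 0 0 ^+ 2 + X 1 0 ^+ 2 + 1 in uE *.
have nE : n = r ^+ 2 + 1.
  by rewrite /n aE cE -[r ^+ 2]mulr1 -cs; ring.
split.
  have -> : n / (r * k) * (c * k + s * (u * k)) = (c * n + s * (u * n)) / r.
    by field; rewrite rn kn.
  rewrite uE nE aE cE; apply: (mulIf rn); rewrite divfK//.
  apply/eqP; rewrite -subr_eq0; apply/eqP.
  transitivity (c * (r * (c * X 1 1 - s * X 0 1) - 1) + r * X 1 1 * (1 - (c ^+ 2 + s ^+ 2))).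
    by ring.
  by rewrite r1 cs; ring.
have -> : n / (r * k) * (s * k - c * (u * k)) = (s * n - c * (u * n)) / r.
  by field; rewrite rn kn.
rewrite uE nE aE cE; apply: (mulIf rn); rewrite divfK//.
apply/eqP; rewrite -subr_eq0; apply/eqP.
transitivity (s * (r * (c * X 1 1 - s * X 0 1) - 1) - r * X 0 1 * (1 - (c ^+ 2 + s ^+ 2))).
  by ring.
by rewrite r1 cs; ring.
Qed.

Lemma mquot_continuous (T : topologicalType) (g : T -> M) :
  (forall i j, continuous (fun s => g s i j)) -> continuous (fun s => atan (mquot (g s))).
Proof.
move=> cg; apply: (@cts_comp R T (fun s => mquot (g s)) atan); last first.
  by move=> x; exact: continuous_atan.
apply: ctsM; first by apply: ctsD; apply: ctsM.
have cn : continuous (fun s => g s 0 0 ^+ 2 + g s 1 0 ^+ 2 + 1).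
  by apply: ctsD; [apply: ctsD; apply: cts_sqr|exact: cts_cst].
move=> x; apply: cvgV; last exact: cn.
by rewrite gt_eqF// ltr_wpDl// addr_ge0// sqr_ge0.
Qed.

(** This is [|z|^2 = |X|^2 + 2 * \det X]; in particular [z] stays away from zero. *)
Lemma polar_sqr (X : M) (rho f : R) : \det X = 1 ->
  X 0 0 + X 1 1 = rho * cos f -> X 1 0 - X 0 1 = rho * sin f ->
  rho ^+ 2 = X 0 0 ^+ 2 + X 0 1 ^+ 2 + X 1 0 ^+ 2 + X 1 1 ^+ 2 + 2.
Proof.
rewrite det2E => dt h1 h2.
have -> : rho ^+ 2 = (rho * cos f) ^+ 2 + (rho * sin f) ^+ 2.
  by rewrite !exprMn -mulrDr cos2Dsin2 mulr1.
rewrite -h1 -h2.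
transitivity (X 0 0 ^+ 2 + X 0 1 ^+ 2 + X 1 0 ^+ 2 + X 1 1 ^+ 2 +
  2 * (X 0 0 * X 1 1 - X 0 1 * X 1 0)); first by ring.
by rewrite dt mulr1.
Qed.

(** Since [z] is Lipschitz, bounded and of modulus at least one, the sine of a phase difference
    satisfies a Lipschitz bound. The phase is continuous, so [sin_lower] removes the sine locally,
    and [lip_of_local] makes the bound global. *)
Lemma phase_lip (t1 : R) (g : R -> M) (th : R -> R) : 0 <= t1 ->
  (forall t, 0 <= t <= t1 -> in_G (g t) (th t)) ->
  (forall i j, lip 0 t1 (fun t => g t i j)) ->
  (forall t, 0 <= t <= t1 -> forall e : R, 0 < e -> exists2 d : R, 0 < d &
         forall s, 0 <= s <= t1 -> `|s - t| < d -> `|th s - th t| < e) ->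
  lip 0 t1 (fun t => phase (g t) (th t)).
Proof.
move=> t10 inG lg cth; set F := fun t => _.
have [d0 d00 sinle] := sin_lower R.
have lZr : lip 0 t1 (fun t => g t 0 0 + g t 1 1) by apply: lipD.
have lZi : lip 0 t1 (fun t => g t 1 0 - g t 0 1) by apply: lipB.
have [B [B0 ZrB]] := lip_bounded lZr; have [D [D0 ZiD]] := lip_bounded lZi.
have [k [k0 kZr]] := lip_pos lZr; have [l [l0 lZi']] := lip_pos lZi.
pose K := l * B + k * D.
have K0 : 0 <= K by rewrite addr_ge0// mulr_ge0.
have sinK s t : 0 <= s <= t1 -> 0 <= t <= t1 -> `|sin (F s - F t)| <= K * `|s - t|.
  move=> s01 t01.
  have [rs rs0 [Zrs Zis]] := phase_polar (inG _ s01).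
  have [rt rt0 [Zrt Zit]] := phase_polar (inG _ t01).
  have rs1 : 1 <= rs.
    have := polar_sqr (inG _ s01).1 Zrs Zis.
    have := sqr_ge0 (g s 0 0); have := sqr_ge0 (g s 0 1);
    have := sqr_ge0 (g s 1 0); have := sqr_ge0 (g s 1 1); nra.
  have rt1 : 1 <= rt.
    have := polar_sqr (inG _ t01).1 Zrt Zit.
    have := sqr_ge0 (g t 0 0); have := sqr_ge0 (g t 0 1);
    have := sqr_ge0 (g t 1 0); have := sqr_ge0 (g t 1 1); nra.
  apply: (@le_trans _ _ `|rs * rt * sin (F s - F t)|).
    rewrite normrM ler_peMl// ger0_norm; first by nra.
    by rewrite mulr_ge0// ltW.
  (* Both sides are the imaginary part of [z] at [s] times the conjugate of [z] at [t]. *)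
  have -> : rs * rt * sin (F s - F t) =
    ((g s 1 0 - g s 0 1) - (g t 1 0 - g t 0 1)) * (g t 0 0 + g t 1 1)
    - ((g s 0 0 + g s 1 1) - (g t 0 0 + g t 1 1)) * (g t 1 0 - g t 0 1).
    by rewrite Zrs Zis Zrt Zit sinB /F; ring.
  apply: (le_trans (ler_normB _ _)); rewrite /K [leRHS]mulrDl !normrM lerD//.
    by rewrite mulrAC ler_pM ?lZi' ?ZrB.
  by rewrite mulrAC ler_pM ?kZr ?ZiD.
exists (2 * K); apply: lip_of_local; first by rewrite mulr_ge0.
move=> t t01.
have cG : continuous (fun s => atan (mquot (g (clamp 0 t1 s)))).
  apply: mquot_continuous => i j; have [m mg] := lg i j.
  apply: (@lipschitz_continuous_real R _ `|m|) => x y.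
  apply: (le_trans (mg _ _ (clamp_in _ t10) (clamp_in _ t10))).
  apply: (@le_trans _ _ (`|m| * `|clamp 0 t1 x - clamp 0 t1 y|)).
    by rewrite ler_wpM2r// ler_norm.
  by rewrite ler_wpM2l//; exact: clamp_lip.
have d02 : 0 < d0 / 2 by exact: divr_gt0.
have [d1 d10 Hd1] := cth t t01 _ d02.
have /cvgrPdist_lt/(_ _ d02)/nbhs_ballP[d2 /= d20 Hd2] := cG t.
exists (Num.min d1 d2); first by rewrite lt_min d10.
move=> s s01; rewrite lt_min => /andP[sd1 sd2].
have h1 := Hd1 s s01 sd1.
have := Hd2 s; rewrite /ball/= distrC => /(_ sd2); rewrite !clamp_id// => h2.
rewrite -mulrA; apply: le_trans (ler_wpM2l _ (sinK _ _ s01 t01)) => //.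
apply: sinle; rewrite /F /phase.
have -> : th s - atan (mquot (g s)) - (th t - atan (mquot (g t))) =
  (th s - th t) + (atan (mquot (g t)) - atan (mquot (g s))) by ring.
apply: (le_lt_trans (ler_normD _ _)); lra.
Qed.

Lemma abs_le_of_sqr (x y : R) : 0 <= y -> x ^+ 2 <= y ^+ 2 -> `|x| <= y.
Proof. by move=> y0 xy; rewrite ler_norml; apply/andP; split; nra. Qed.

Lemma cauchy_schwarz2 (x1 x2 y1 y2 : R) :
  (x1 * y1 - x2 * y2) ^+ 2 <= (x1 ^+ 2 + x2 ^+ 2) * (y1 ^+ 2 + y2 ^+ 2).
Proof.
rewrite -subr_ge0; set X := (X in 0 <= X).
have -> : X = (x1 * y2 + x2 * y1) ^+ 2 by rewrite /X; ring.
exact: sqr_ge0.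
Qed.

(** Differentiation gives [f' * rho = alpha * rho + E], where [E] collects the terms in [beta]. By
    Cauchy-Schwarz [|E|] is at most [|beta|] times the length of [(a - e, b + c')], which is at most
    [rho]. *)
Lemma phase_derive_ge (g : R -> M) (th : R -> R) (t f' d eps delta : R) (v : M) :
  0 < d -> (forall s, `|s - t| < d -> in_G (g s) (th s)) ->
  (forall i j, is_derive t 1 (fun s => g s i j) ((g t *m v) i j)) ->
  is_derive t 1 (fun s => phase (g s) (th s)) f' ->
  eps = 1 \/ eps = -1 -> delta < 1 ->
  v 1 1 = - v 0 0 ->
  let al := eps * (v 1 0 - v 0 1) / 2 in 0 <= al ->
  v 0 0 ^+ 2 + ((v 0 1 + v 1 0) / 2) ^+ 2 <= ((1 - delta) * al) ^+ 2 ->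
  delta * al <= eps * f'.
Proof.
move=> d0 inG dg df epsE delta1 v11 al al0 gap.
have eps2 : eps ^+ 2 = 1 by case: epsE => ->; rewrite ?sqrrN expr1n.
pose F s := phase (g s) (th s).
have Gt : in_G (g t) (th t) by apply: inG; rewrite subrr normr0.
have [rho rho0 [Zr Zi]] := phase_polar Gt.
have rho2 := polar_sqr Gt.1 Zr Zi.
(* [P] vanishes near [t] because [z] has argument [F]; the product rule then gives a linear equation
   for [f']. *)
pose P s := (g s 0 0 + g s 1 1) * sin (F s) - (g s 1 0 - g s 0 1) * cos (F s).
have dP0 : is_derive t 1 P 0.
  apply: near_eq_is_derive (isd_cst 0 t).
  apply/nbhs_ballP; exists d => //= s; rewrite /ball/= distrC => /inG Gs.
  by have [r _ [h1 h2]] := phase_polar Gs; rewrite /P h1 h2 /F; ring.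
have dP := isdB (isdM (isdD (dg 0 0) (dg 1 1)) (isd_sin df))
                (isdM (isdB (dg 1 0) (dg 0 1)) (isd_cos df)).
have := isd_uniq dP0 dP; rewrite !mul2E v11 -/(F t).
set c := cos (F t) in Zr *; set s := sin (F t) in Zi *.
have cs : c ^+ 2 + s ^+ 2 = 1 by exact: cos2Dsin2.
set p := v 0 0 in gap *; set q := v 0 1 in al al0 gap *; set r := v 1 0 in al al0 gap *.
pose a := g t 0 0; pose b := g t 0 1; pose c' := g t 1 0; pose e := g t 1 1.
rewrite -/a -/b -/c' -/e in Zr Zi rho2 *.
pose E := p * ((b + c') * c - (a - e) * s) - (q + r) / 2 * ((a - e) * c + (b + c') * s).
move=> eq0.
have eqf : f' * rho = (r - q) / 2 * rho + E.
  have rc : rho = (a + e) * c + (c' - b) * s.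
    by rewrite Zr Zi -[LHS]mulr1 -cs; ring.
  rewrite rc; apply/eqP; rewrite -subr_eq0; apply/eqP.
  by rewrite [RHS]eq0 /E; field.
have E2 : E ^+ 2 <= (((1 - delta) * al) * rho) ^+ 2.
  have W : (a - e) ^+ 2 + (b + c') ^+ 2 <= rho ^+ 2.
    have := Gt.1; rewrite det2E -/a -/b -/c' -/e => dt.
    rewrite rho2; nra.
  have CS : E ^+ 2 <= (p ^+ 2 + ((q + r) / 2) ^+ 2) * ((a - e) ^+ 2 + (b + c') ^+ 2).
    have -> : (a - e) ^+ 2 + (b + c') ^+ 2 =
      ((b + c') * c - (a - e) * s) ^+ 2 + ((a - e) * c + (b + c') * s) ^+ 2.
      by rewrite -[LHS]mulr1 -cs; ring.
    exact: cauchy_schwarz2.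
  apply: (le_trans CS); rewrite [leRHS]exprMn.
  by apply: ler_pM => //; rewrite addr_ge0// sqr_ge0.
have Eabs : `|E| <= (1 - delta) * al * rho.
  apply: abs_le_of_sqr => //; apply: mulr_ge0; last exact: ltW.
  by apply: mulr_ge0 => //; rewrite subr_ge0 ltW.
rewrite -(ler_pM2r rho0) -[eps * f' * rho]mulrA eqf mulrDr.
have -> : eps * ((r - q) / 2 * rho) = al * rho by rewrite /al; ring.
have : `|eps * E| <= (1 - delta) * al * rho.
  by rewrite normrM; case: epsE => ->; rewrite ?normrN normr1 mul1r.
rewrite ler_norml => /andP[h _]; lra.
Qed.
End Phase.

(** * A priori estimates along admissible curves *)

Section Adjugate.
Variable R : realType.
Notation M := 'M[R]_2.

(** The adjugate replaces the inverse because its entries are continuous on all matrices. *)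
Definition adj2 (X : M) : M :=
  \matrix_(i, j) (if i == j then X (1 - i) (1 - i) else - X i j).

Lemma sub1ord0 : 1 - 0 = 1 :> 'I_2. Proof. by rewrite subr0. Qed.
Lemma sub1ord1 : 1 - 1 = 0 :> 'I_2. Proof. by rewrite subrr. Qed.

Lemma adj2E (X : M) : [/\ adj2 X 0 0 = X 1 1, adj2 X 0 1 = - X 0 1,
  adj2 X 1 0 = - X 1 0 & adj2 X 1 1 = X 0 0].
Proof. by rewrite !mxE/= sub1ord0 sub1ord1. Qed.

Lemma adj2_mul (X : M) : \det X = 1 -> adj2 X *m X = 1%:M.
Proof.
rewrite det2E => dt; have [h1 h2 h3 h4] := adj2E X.
by apply: mx2P; rewrite mul2E ?h1 ?h2 ?h3 ?h4 !mxE/= -?dt; ring.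
Qed.

Lemma adj2_inv (X : M) : \det X = 1 -> invmx X = adj2 X.
Proof.
move=> dt; have uX : X \in unitmx by rewrite unitmxE dt unitr1.
by rewrite -[RHS](mulmxK uX) adj2_mul// mul1mx.
Qed.

Definition mxnorm1 (f : M) : R := `|f 0 0| + `|f 0 1| + `|f 1 0| + `|f 1 1|.

Lemma mxdot_mul (f A X : M) : mxdot f (A *m X) = mxdot (A^T *m f) X.
Proof. by rewrite /mxdot !mul2E !mxE; ring. Qed.

Lemma mxdotD (f X Y : M) : mxdot f (X + Y) = mxdot f X + mxdot f Y.
Proof. by rewrite /mxdot !mxE; ring. Qed.

Lemma mxdotB (f X Y : M) : mxdot f (X - Y) = mxdot f X - mxdot f Y.
Proof. by rewrite /mxdot !mxE; ring. Qed.

Lemma mulmx_le (X Y : M) (x y : R) : (forall i j, `|X i j| <= x) ->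
  (forall i j, `|Y i j| <= y) -> forall i j, `|(X *m Y) i j| <= 2 * x * y.
Proof.
move=> hX hY i j; rewrite mul2E.
apply: (le_trans (ler_normD _ _)); rewrite !normrM.
have h1 : `|X i 0| * `|Y 0 j| <= x * y by apply: ler_pM.
have h2 : `|X i 1| * `|Y 1 j| <= x * y by apply: ler_pM.
lra.
Qed.

Lemma isd_mxdot (f : M) (g : R -> M) (t : R) (g' : M) :
  (forall i j, is_derive t 1 (fun s => g s i j) (g' i j)) ->
  is_derive t 1 (fun s => mxdot f (g s)) (mxdot f g').
Proof.
move=> dg; rewrite /mxdot.
exact: (isdD (isdD (isdD (isdZ _ (dg 0 0)) (isdZ _ (dg 0 1))) (isdZ _ (dg 1 0))) (isdZ _ (dg 1 1))).
Qed.

Lemma lip_mxdot (a b : R) (f : M) (g : R -> M) :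
  (forall i j, lip a b (fun s => g s i j)) -> lip a b (fun s => mxdot f (g s)).
Proof.
move=> lg; rewrite /mxdot; do 3 (apply: lipD; last exact: lipZ); exact: lipZ.
Qed.
End Adjugate.

Section Candidate.
Variables (R : realType) (C : set 'M[R]_2) (nu : 'M[R]_2 -> \bar R).
Notation M := 'M[R]_2.
Notation mu := (@lebesgue_measure R).
Hypothesis coneC : closed_convex_acute_cone C.
Variables (eps delta : R).
Hypothesis epsE : eps = 1 \/ eps = -1.
Hypothesis delta01 : 0 < delta < 1.
Hypothesis gap : forall v, C v -> let al := eps * (v 1 0 - v 0 1) / 2 in
    [/\ 0 <= al, v != 0 -> 0 < al &
     v 0 0 ^+ 2 + ((v 0 1 + v 1 0) / 2) ^+ 2 <= ((1 - delta) * al) ^+ 2].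
Variable f0 : M.
Hypothesis f0nu : forall v, C v -> fine (nu v) <= mxdot f0 v.

Variables (t1 : R) (g : R -> M) (th : R -> R).
Hypothesis adm : admissible C t1 g th.

(** The entries of [v] are at most [2 * al], and [delta * al] is at most the rate of [tau]. *)
Let c1 := 2 / delta.
Let c1_ge0 : 0 <= c1.
Proof. by move: delta01 => /andP[d0 _]; rewrite /c1 divr_ge0// ltW. Qed.

(** The time function, with the orientation in which it increases along admissible curves. *)
Definition tau t : R := eps * phase (g t) (th t).

Lemma cand_lipg i j : lip 0 t1 (fun t => g t i j).
Proof. by have [_ _ [k kg] _ _] := adm; exists k => x y; exact: kg. Qed.

Lemma cand_liptau : lip 0 t1 tau.
Proof.
have [t10 inG _ cth _] := adm; apply: lipZ; apply: phase_lip => //.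
exact: cand_lipg.
Qed.

(** What holds at almost every parameter: [v] is the body velocity and [d] the rate of [tau], which
    controls [v]. *)
Definition regular_at (x : R) (v : M) (d : R) := [/\ C v /\ v = body_vel g x,
  forall i j, is_derive x 1 (fun s => g s i j) ((g x *m v) i j),
  is_derive x 1 tau d, (forall i j, `|v i j| <= c1 * d) & 0 <= d].

Lemma cand_regular : {ae mu, forall x, 0 < x < t1 -> exists v d, regular_at x v d}.
Proof.
have [t10 inG _ cth vel] := adm.
have [k kp] := phase_lip t10 inG cand_lipg cth.
have dp := lipschitz_ae_derivable kp.
apply: (@filterS2 _ _ (ae_filter_ringOfSetsType mu) _ _ _ _ vel dp) => x H1 H2 x01.
have /andP[x0 xt] := x01.
have xI : 0 <= x <= t1 by rewrite !ltW.
have [|dg [Cv v0]] := H1; first by rewrite in_itv/=.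
have dphi := derivable_isd (H2 x01).
set v := body_vel g x in Cv v0.
have ux : g x \in unitmx by rewrite unitmxE (inG _ xI).1 unitr1.
have gv : g x *m v = mx_deriv g x by rewrite /v /body_vel mulKVmx.
have dgv i j : is_derive x 1 (fun s => g s i j) ((g x *m v) i j).
  by rewrite gv mxE; apply: derivable_isd; exact: dg.
have [al0 _ gp] := gap Cv.
have /andP[d0 d1] := delta01.
exists v, (eps * derive1 (fun t => phase (g t) (th t)) x).
have taud : delta * (eps * (v 1 0 - v 0 1) / 2) <=
    eps * derive1 (fun t => phase (g t) (th t)) x.
  apply: (@phase_derive_ge R g th x _ (Num.min x (t1 - x)) eps delta v) => //.
  - by rewrite lt_min x0 subr_gt0.
  - move=> s; rewrite lt_min ltr_norml ltr_norml => /andP[/andP[h1 h2] /andP[h3 h4]].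
    apply: inG; apply/andP; split; lra.
  - exact: (cone_tr coneC Cv).
set al := eps * _ / 2 in al0 gp taud.
split => //; first exact: isdZ.
  have al2 : 2 * al <= c1 * (eps * derive1 (fun t => phase (g t) (th t)) x).
    by rewrite /c1 mulrAC ler_pdivlMr// mulrAC -mulrA ler_pM2l.
  have eps2 : eps ^+ 2 = 1 by case: epsE => ->; rewrite ?sqrrN expr1n.
  have alE : ((v 1 0 - v 0 1) / 2) ^+ 2 = al ^+ 2.
    by rewrite /al -mulrA [RHS]exprMn eps2 mul1r.
  have gp' : v 0 0 ^+ 2 + ((v 0 1 + v 1 0) / 2) ^+ 2 <= al ^+ 2.
    apply: (le_trans gp); rewrite exprMn ler_piMl ?sqr_ge0//; nra.
  have p_al : `|v 0 0| <= al.
    by apply: abs_le_of_sqr => //; have := sqr_ge0 ((v 0 1 + v 1 0) / 2); lra.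
  have b_al : `|(v 0 1 + v 1 0) / 2| <= al.
    by apply: abs_le_of_sqr => //; have := sqr_ge0 (v 0 0); lra.
  have a_al : `|(v 1 0 - v 0 1) / 2| <= al by apply: abs_le_of_sqr => //; rewrite alE.
  move: p_al b_al a_al; rewrite !ler_norml => /andP[p1 p2] /andP[b1 b2] /andP[a1 a2].
  move=> i j; apply: le_trans al2; rewrite ler_norml.
  have v11 := cone_tr coneC Cv.
  by have [->|->] := ord2P i; have [->|->] := ord2P j; rewrite ?v11; apply/andP; split; lra.
by apply: le_trans taud; rewrite mulr_ge0// ltW.
Qed.

(** Every estimate below is the monotonicity of some [F], checked at regular points. [Q] carries one
    more almost everywhere property, such as the differentiability of [y]. *)
Lemma cand_mono (Q : R -> Prop) (F : R -> R) (s t : R) :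
  0 <= s -> s <= t -> t <= t1 -> lip 0 t1 F ->
  {ae mu, forall x, 0 < x < t1 -> Q x} ->
  (forall x v d, s < x < t -> Q x -> regular_at x v d ->
     exists2 l, is_derive x 1 F l & 0 <= l) -> F s <= F t.
Proof.
move=> s0 st tt1 [k kF] aeQ H; apply: (@ae_derive_ge0_le R F k s t st).
  move=> x y /andP[sx xt] /andP[sy yt]; apply: kF.
    by rewrite (le_trans s0 sx) (le_trans xt tt1).
  by rewrite (le_trans s0 sy) (le_trans yt tt1).
apply: (@filterS2 _ _ (ae_filter_ringOfSetsType mu) _ _ _ _ aeQ cand_regular) => x Qx H2.
move=> /[dup] sxt /andP[sx xt] _.
have x01 : 0 < x < t1 by rewrite (le_lt_trans s0 sx) (lt_le_trans xt tt1).
have [v [d fx]] := H2 x01.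
have [l dl l0] := H x v d sxt (Qx x01) fx.
by have [_ ->] := isd_derive1 dl.
Qed.

Lemma ae_true : {ae mu, forall x, 0 < x < t1 -> True}.
Proof. exact: aeW. Qed.

Lemma cand_tau s t : 0 <= s -> s <= t -> t <= t1 -> tau s <= tau t.
Proof.
move=> s0 st tt1; apply: (cand_mono s0 st tt1 cand_liptau ae_true).
by move=> x v d _ _ [_ _ dt _ d0]; exists d.
Qed.

Definition sqn (X : M) : R := X 0 0 ^+ 2 + X 0 1 ^+ 2 + X 1 0 ^+ 2 + X 1 1 ^+ 2.

Lemma cross_le (a b w m : R) : `|w| <= 2 * m -> a * b * w <= (a ^+ 2 + b ^+ 2) * m.
Proof.
rewrite ler_norml => /andP[w1 w2].
have h1 : 0 <= (m + w / 2) * (a - b) ^+ 2 by rewrite mulr_ge0 ?sqr_ge0//; lra.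
have h2 : 0 <= (m - w / 2) * (a + b) ^+ 2 by rewrite mulr_ge0 ?sqr_ge0//; lra.
nra.
Qed.

(** Gronwall: at regular points the rate of [sqn g] is at most [4 * c1 * sqn g] times the rate of
    [tau], so the product in [F] is nonincreasing. *)
Lemma cand_growth t : 0 <= t -> t <= t1 ->
  sqn (g t) <= sqn (g 0) * expR (4 * c1 * (tau t - tau 0)).
Proof.
move=> t0 tt1.
pose F x := - (sqn (g x) * expR (- (4 * c1) * tau x)).
have lN : lip 0 t1 (fun x => sqn (g x)).
  by do 3 (apply: lipD; last exact/lip_sqr/cand_lipg); exact/lip_sqr/cand_lipg.
have lF : lip 0 t1 F.
  apply: lipN; apply: lipM => //; apply: lip_expR; apply: lipZ; exact: cand_liptau.
have : F 0 <= F t.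
  apply: (cand_mono _ _ _ lF ae_true) => // x v d _ _ [_ dg dt vd d0].
  have dN := isdD (isdD (isdD (isd_sqr (dg 0 0)) (isd_sqr (dg 0 1)))
                        (isd_sqr (dg 1 0))) (isd_sqr (dg 1 1)).
  eexists; first exact: (isdN (isdM dN (isd_expR (isdZ (- (4 * c1)) dt)))).
  set l := (X in 0 <= X).
  have e0 := expR_gt0 (- (4 * c1) * tau x).
  pose N' := 2 * g x 0 0 * (g x *m v) 0 0 + 2 * g x 0 1 * (g x *m v) 0 1 +
    2 * g x 1 0 * (g x *m v) 1 0 + 2 * g x 1 1 * (g x *m v) 1 1.
  have -> : l = expR (- (4 * c1) * tau x) * (4 * (c1 * d) * sqn (g x) - N').
    by rewrite /l /N' /sqn; ring.
  apply: mulr_ge0; first exact: ltW.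
  rewrite subr_ge0 /N' /sqn !mul2E.
  set m := c1 * d in vd *.
  have w : `|v 0 1 + v 1 0| <= 2 * m.
    by apply: (le_trans (ler_normD _ _)); have := vd 0 1; have := vd 1 0; lra.
  have h1 := cross_le (g x 0 0) (g x 0 1) w.
  have h2 := cross_le (g x 1 0) (g x 1 1) w.
  have h (y u : R) : `|u| <= m -> y ^+ 2 * u <= y ^+ 2 * m.
    by move=> um; rewrite ler_wpM2l ?sqr_ge0// (le_trans (ler_norm _)).
  have := h (g x 0 0) _ (vd 0 0); have := h (g x 0 1) _ (vd 1 1).
  have := h (g x 1 0) _ (vd 0 0); have := h (g x 1 1) _ (vd 1 1).
  lra.
rewrite /F lerN2 => h.
have -> : expR (4 * c1 * (tau t - tau 0)) =
    expR (- (4 * c1) * tau 0) / expR (- (4 * c1) * tau t).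
  by rewrite -expRN -expRD; congr expR; ring.
by rewrite mulrA ler_pdivlMr// expR_gt0.
Qed.

Variables (T : R) (X0 : M).
Hypothesis TE : tau t1 - tau 0 = T.
Hypothesis g0E : g 0 = X0.

(** The first summand bounds the squares of the entries; adding one makes it a bound for the entries
    themselves. *)
Definition gbound : R := sqn X0 * expR (4 * c1 * T) + 1.

Lemma cand_bound t i j : 0 <= t -> t <= t1 -> `|g t i j| <= gbound.
Proof.
move=> t0 tt1.
have s0 k l (X : M) : X k l ^+ 2 <= sqn X.
  rewrite /sqn; have := sqr_ge0 (X 0 0); have := sqr_ge0 (X 0 1).
  have := sqr_ge0 (X 1 0); have := sqr_ge0 (X 1 1).
  by have [->|->] := ord2P k; have [->|->] := ord2P l; lra.
have N0 : 0 <= sqn X0 by apply: le_trans (s0 0 0 _); exact: sqr_ge0.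
have h : g t i j ^+ 2 <= sqn X0 * expR (4 * c1 * T).
  apply: (le_trans (s0 i j (g t))); apply: (le_trans (cand_growth t0 tt1)); rewrite g0E.
  apply: ler_wpM2l => //; rewrite ler_expR; apply: ler_wpM2l; first exact: mulr_ge0.
  by rewrite -TE lerD2r; exact: cand_tau.
rewrite /gbound; set S := sqn _ * _ in h *.
have S0 : 0 <= S by apply: le_trans h; exact: sqr_ge0.
by apply: abs_le_of_sqr; nra.
Qed.

Definition glip : R := 2 * gbound * c1.

Lemma cand_gv x v d : regular_at x v d -> 0 <= x -> x <= t1 ->
  forall i j, `|(g x *m v) i j| <= glip * d.
Proof.
move=> [_ _ _ vd _] x0 xt i j; rewrite /glip -mulrA.
by apply: mulmx_le => // k l; exact: cand_bound.
Qed.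

(** Both [glip * tau + g] and [glip * tau - g] are nondecreasing, entry by entry. *)
Lemma cand_lipschitz s t i j : 0 <= s -> s <= t -> t <= t1 ->
  `|g t i j - g s i j| <= glip * (tau t - tau s).
Proof.
move=> s0 st tt1; rewrite ler_norml.
have m1 : glip * tau s + g s i j <= glip * tau t + g t i j.
  apply: (@cand_mono _ (fun x => glip * tau x + g x i j) s t _ _ _ _ ae_true) => //.
    by apply: lipD; [exact/lipZ/cand_liptau|exact: cand_lipg].
  move=> x v d /andP[sx xt] _ fx; have [_ dg dt _ _] := fx.
  eexists; first exact: (isdD (isdZ _ dt) (dg i j)).
  have := cand_gv fx (ltW (le_lt_trans s0 sx)) (ltW (lt_le_trans xt tt1)) i j.
  by rewrite ler_norml => /andP[h _]; lra.
have m2 : glip * tau s - g s i j <= glip * tau t - g t i j.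
  apply: (@cand_mono _ (fun x => glip * tau x - g x i j) s t _ _ _ _ ae_true) => //.
    by apply: lipB; [exact/lipZ/cand_liptau|exact: cand_lipg].
  move=> x v d /andP[sx xt] _ fx; have [_ dg dt _ _] := fx.
  eexists; first exact: (isdB (isdZ _ dt) (dg i j)).
  have := cand_gv fx (ltW (le_lt_trans s0 sx)) (ltW (lt_le_trans xt tt1)) i j.
  by rewrite ler_norml => /andP[_ h]; lra.
by apply/andP; split; lra.
Qed.

Variables (y h : R -> R).
Hypothesis ly : lip 0 t1 y.
Hypothesis dy : {ae mu, forall x, 0 < x < t1 -> is_derive x 1 y (h x)}.
Hypothesis hnu : forall x, 0 < x < t1 -> C (body_vel g x) ->
  0 <= h x <= fine (nu (body_vel g x)).

Definition ylip : R := mxnorm1 f0 * c1.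

(** The rate [h] of [y] lies between zero and [nu v], and the latter is at most [mxdot f0 v], hence
    at most [ylip] times the rate of [tau]. *)
Lemma cand_y s t : 0 <= s -> s <= t -> t <= t1 ->
  0 <= y t - y s <= ylip * (tau t - tau s).
Proof.
move=> s0 st tt1; apply/andP; split.
  rewrite subr_ge0; apply: (cand_mono s0 st tt1 ly dy) => x v d /andP[sx xt] dyx [[Cv vE] _ _ _ _].
  have x01 : 0 < x < t1 by rewrite (le_lt_trans s0 sx) (lt_le_trans xt tt1).
  by exists (h x) => //; rewrite vE in Cv; have /andP[] := hnu x01 Cv.
suff : ylip * tau s - y s <= ylip * tau t - y t by lra.
apply: (cand_mono (F := fun x => ylip * tau x - y x) s0 st tt1 _ dy).
  by apply: lipB => //; exact/lipZ/cand_liptau.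
move=> x v d /andP[sx xt] dyx [[Cv vE] _ dt vd _].
have x01 : 0 < x < t1 by rewrite (le_lt_trans s0 sx) (lt_le_trans xt tt1).
eexists; first exact: (isdB (isdZ _ dt) dyx).
have /andP[_ h2] : 0 <= h x <= fine (nu v) by rewrite vE; apply: hnu => //; rewrite -vE.
rewrite subr_ge0 (le_trans h2)// (le_trans (f0nu Cv))//.
rewrite (le_trans (ler_norm _))// /ylip -mulrA; exact: mxdot_le.
Qed.

Definition incl_cst : R := 2 * gbound * glip * c1.

(** The inequality [q * h <= mxdot f v] is integrated with the base point frozen at [g s]. The
    freezing error has rate of order [tau x - tau s] times the rate of [tau], hence integrates to a
    square. *)
Lemma cand_incl s t f q : 0 <= s -> s <= t -> t <= t1 -> dual C nu f q ->
  q * (y t - y s) <= mxdot f (adj2 (g s) *m (g t - g s)) +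
    mxnorm1 f * incl_cst * (tau t - tau s) ^+ 2.
Proof.
move=> s0 st tt1 [q0 fq].
pose F x := mxdot f (adj2 (g s) *m (g x - g s)) + mxnorm1 f * incl_cst * (tau x - tau s) ^+ 2 - q * y x.
suff : F s <= F t.
  rewrite /F !subrr mulmx0 expr0n /= mulr0.
  have -> : mxdot f 0 = 0 by rewrite /mxdot !mxE; ring.
  lra.
pose G x := mxdot ((adj2 (g s))^T *m f) (g x) - mxdot f (adj2 (g s) *m g s) +
    mxnorm1 f * incl_cst * (tau x - tau s) ^+ 2 - q * y x.
have -> : F = G by apply/funext => x; rewrite /F /G mulmxBr mxdotB -mxdot_mul.
apply: (@cand_mono _ G s t s0 st tt1 _ dy).
  apply: lipB; last exact: lipZ.
  apply: lipD.
    by apply: lipB; [exact/lip_mxdot/cand_lipg|exact: lip_cst].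
  by apply/lipZ/lip_sqr/lipB; [exact: cand_liptau|exact: lip_cst].
move=> x v d /andP[sx xt] dyx [[Cv vE] dg dt vd d0].
have x0 : 0 <= x by exact: ltW (le_lt_trans s0 sx).
have xt1 : x <= t1 by exact: ltW (lt_le_trans xt tt1).
have x01 : 0 < x < t1 by rewrite (le_lt_trans s0 sx) (lt_le_trans xt tt1).
have tau0 : 0 <= tau x - tau s by rewrite subr_ge0; exact: cand_tau s0 (ltW sx) xt1.
have s1 : s <= t1 by exact: le_trans st tt1.
eexists.
  exact: (isdB (isdD (isdB (isd_mxdot _ dg) (isd_cst _ _))
    (isdZ _ (isd_sqr (isdB dt (isd_cst _ _))))) (isdZ _ dyx)).
rewrite !subr0 -mxdot_mul.
have inv : adj2 (g s) *m g s = 1%:M.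
  have [_ inG _ _ _] := adm; apply: adj2_mul.
  by apply: (inG s _).1; rewrite s0.
(* The velocity seen from [g s] is [v] plus the freezing error. *)
have -> : adj2 (g s) *m (g x *m v) = v + (adj2 (g s) *m (g x - g s)) *m v.
  by rewrite mulmxBr inv mulmxBl mul1mx addrC subrK mulmxA.
have E : forall i j, `|((adj2 (g s) *m (g x - g s)) *m v) i j| <=
    2 * (2 * gbound * (glip * (tau x - tau s))) * (c1 * d).
  apply: mulmx_le => //; apply: mulmx_le => i j.
    by rewrite mxE; case: ifP => _; rewrite ?normrN; exact: cand_bound.
  by rewrite !mxE; apply: cand_lipschitz => //; exact: ltW.
have := mxdot_le f E; rewrite -/(mxnorm1 f) ler_norml => /andP[e1 _].
rewrite mxdotD.
have /andP[_ h2] : 0 <= h x <= fine (nu v) by rewrite vE; apply: hnu => //; rewrite -vE.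
have h3 : q * h x <= mxdot f v by apply: (le_trans _ (fq _ Cv)); rewrite ler_wpM2l.
have -> : mxnorm1 f * incl_cst * (2 * (tau x - tau s) * d) =
  mxnorm1 f * (2 * (2 * gbound * (glip * (tau x - tau s))) * (c1 * d)) by rewrite /incl_cst; ring.
lra.
Qed.
End Candidate.

(** * The compact set of arcs *)

Section ContinuousMatrix.
Variables (R : realType) (T : topologicalType).
Notation M := 'M[R]_2.
Implicit Types A B : T -> M.

Definition ctsmx A := forall i j, continuous (fun w => A w i j).

Lemma ctsmx_mul A B : ctsmx A -> ctsmx B -> ctsmx (fun w => A w *m B w).
Proof.
move=> cA cB i j.
have -> : (fun w => (A w *m B w) i j) = (fun w => A w i 0 * B w 0 j + A w i 1 * B w 1 j).
  by apply/funext => w; rewrite mul2E.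
by apply: ctsD; apply: ctsM.
Qed.

Lemma ctsmxB A B : ctsmx A -> ctsmx B -> ctsmx (fun w => A w - B w).
Proof.
move=> cA cB i j.
have -> : (fun w => (A w - B w) i j) = (fun w => A w i j - B w i j).
  by apply/funext => w; rewrite !mxE.
exact: ctsB.
Qed.

Lemma ctsmx_adj2 A : ctsmx A -> ctsmx (fun w => adj2 (A w)).
Proof.
move=> cA i j.
have -> : (fun w => adj2 (A w) i j) =
    (fun w => if i == j then A w (1 - i) (1 - i) else - A w i j).
  by apply/funext => w; rewrite !mxE.
by case: (i == j); [exact: cA|exact: ctsN].
Qed.

Lemma cts_mxdot f A : ctsmx A -> continuous (fun w => mxdot f (A w)).
Proof.
move=> cA; have m i j : continuous (fun w => f i j * A w i j).
  by apply: ctsM; [exact: cts_cst|exact: cA].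
exact: (ctsD (ctsD (ctsD (m 0 0) (m 0 1)) (m 1 0)) (m 1 1)).
Qed.
End ContinuousMatrix.

Section Arcs.
Variables (R : realType) (C : set 'M[R]_2) (nu : 'M[R]_2 -> \bar R).
Notation M := 'M[R]_2.
Notation mu := (@lebesgue_measure R).
Variables (eps T : R) (X0 X1 : M) (th0 : R) (L Mb K B : R).

(** At each parameter, [Some ij] indexes a matrix entry and [None] the accumulated length. *)
Definition arc_index : choiceType := (R * option ('I_2 * 'I_2))%type.
Definition arc_mx (w : pw R arc_index) (u : R) : M := mx_of_fun (fun ij => w (u, Some ij)).
Definition arc_len (w : pw R arc_index) (u : R) : R := w (u, None).
(** The phase is prescribed to be affine in [u], so the angle is recovered from the matrix and needs
    no coordinate of its own. *)
Definition arc_angle (w : pw R arc_index) (u : R) : R :=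
  eps * (eps * phase X0 th0 + T * u) + atan (mquot (arc_mx w u)).

(* Curves parametrised proportionally to the phase, together with a primitive arc_len of
   a function below nu(velocity); the last condition is the differential inclusion in
   integrated form. Every condition involves finitely many values of w, so that the
   set is closed for pointwise convergence. *)
Definition arcs : set (pw R arc_index) :=
  [set w | forall i j, arc_mx w 0 i j = X0 i j] `&`
  [set w | forall i j, arc_mx w 1 i j = X1 i j] `&`
  [set w | arc_len w 0 = 0] `&`
  [set w | forall u, 0 <= u <= 1 -> \det (arc_mx w u) = 1] `&`
  [set w | forall u, 0 <= u <= 1 -> arc_mx w u 0 0 =
     Num.sqrt (arc_mx w u 0 0 ^+ 2 + arc_mx w u 1 0 ^+ 2) * cos (arc_angle w u)] `&`
  [set w | forall u, 0 <= u <= 1 -> arc_mx w u 1 0 =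
     Num.sqrt (arc_mx w u 0 0 ^+ 2 + arc_mx w u 1 0 ^+ 2) * sin (arc_angle w u)] `&`
  [set w | forall s t i j, 0 <= s <= t -> t <= 1 ->
     `|arc_mx w t i j - arc_mx w s i j| <= L * (t - s)] `&`
  [set w | forall s t, 0 <= s <= t -> t <= 1 -> `|arc_len w t - arc_len w s| <= Mb * (t - s)] `&`
  [set w | forall uo, `|w uo| <= B] `&`
  [set w | forall s t f q, 0 <= s <= t -> t <= 1 -> dual C nu f q ->
     q * (arc_len w t - arc_len w s) <=
       mxdot f (adj2 (arc_mx w s) *m (arc_mx w t - arc_mx w s)) + mxnorm1 f * K * (t - s) ^+ 2].

Lemma ctsmx_arc_mx u : ctsmx (fun w => arc_mx w u).
Proof.
move=> i j; have -> : (fun w => arc_mx w u i j) = (fun w : pw R arc_index => w (u, Some (i, j))).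
  by apply/funext => w; rewrite mxE.
exact: cts_proj.
Qed.

Lemma cts_arc_len u : continuous (fun w => arc_len w u).
Proof. exact: cts_proj. Qed.

Lemma cts_arc_angle u : continuous (fun w => arc_angle w u).
Proof.
apply: ctsD; first exact: cts_cst.
by apply: (@mquot_continuous R _ (fun w => arc_mx w u)) => i j; exact: ctsmx_arc_mx.
Qed.

Lemma arcs_closed : closed arcs.
Proof.
have cg u i j : continuous (fun w => arc_mx w u i j) by exact: ctsmx_arc_mx.
have csq u : continuous (fun w => Num.sqrt (arc_mx w u 0 0 ^+ 2 + arc_mx w u 1 0 ^+ 2)).
  apply: (@cts_comp R _ (fun w => arc_mx w u 0 0 ^+ 2 + arc_mx w u 1 0 ^+ 2) Num.sqrt).
    by apply: ctsD; apply: cts_sqr.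
  exact: sqrt_continuous.
rewrite /arcs; do ?apply: closedI.
- by do 2 apply: closed_forall => ?; apply: closed_eq_cts => //; exact: cts_cst.
- by do 2 apply: closed_forall => ?; apply: closed_eq_cts => //; exact: cts_cst.
- by apply: closed_eq_cts; [exact: cts_arc_len|exact: cts_cst].
- apply: closed_forall => u; apply: closed_imp; apply: closed_eq_cts; last exact: cts_cst.
  have -> : (fun w => \det (arc_mx w u)) =
      (fun w => arc_mx w u 0 0 * arc_mx w u 1 1 - arc_mx w u 0 1 * arc_mx w u 1 0).
    by apply/funext => w; rewrite det2E.
  by apply: ctsB; apply: ctsM.
- apply: closed_forall => u; apply: closed_imp; apply: closed_eq_cts => //.
  apply: ctsM => //; apply: (cts_comp (h := cos)); first exact: cts_arc_angle.
  exact: continuous_cos.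
- apply: closed_forall => u; apply: closed_imp; apply: closed_eq_cts => //.
  apply: ctsM => //; apply: (cts_comp (h := sin)); first exact: cts_arc_angle.
  exact: continuous_sin.
- do 4 apply: closed_forall => ?; do 2 apply: closed_imp; apply: closed_le_cts.
    by apply: cts_norm; apply: ctsB.
  exact: cts_cst.
- do 2 apply: closed_forall => ?; do 2 apply: closed_imp; apply: closed_le_cts.
    by apply: cts_norm; apply: ctsB; exact: cts_arc_len.
  exact: cts_cst.
- apply: closed_forall => uo; apply: closed_le_cts; last exact: cts_cst.
  by apply: cts_norm; exact: cts_proj.
- do 4 apply: closed_forall => ?; do 3 apply: closed_imp; apply: closed_le_cts.
    by apply: ctsM; [exact: cts_cst|apply: ctsB; exact: cts_arc_len].
  apply: ctsD; last exact: cts_cst.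
  apply: cts_mxdot; apply: ctsmx_mul; first exact/ctsmx_adj2/ctsmx_arc_mx.
  by apply: ctsmxB; exact: ctsmx_arc_mx.
Qed.

Lemma arcs_max : arcs !=set0 ->
  exists2 w, arcs w & forall w', arcs w' -> arc_len w' 1 <= arc_len w 1.
Proof.
move=> A0.
apply: (@product_EVT_max R arc_index arcs (fun=> B) (fun w => arc_len w 1) arcs_closed A0).
  by move=> w [[_ wB] _] i; exact: wB.
exact: cts_arc_len.
Qed.

(** * The admissible curve carried by an arc *)

Section LimitCurve.
Hypothesis coneC : closed_convex_acute_cone C.
Hypothesis anti : anti_norm C nu.
Hypothesis usc : upper_semicontinuous nu.
Hypothesis epsE : eps = 1 \/ eps = -1.
Hypothesis T0 : 0 < T.
Variable w : pw R arc_index.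
Hypothesis ww : arcs w.

Let G (u : R) : M := arc_mx w (clamp 0 1 u).
Let Th (u : R) : R := arc_angle w (clamp 0 1 u).
Let Y (u : R) : R := arc_len w (clamp 0 1 u).

Lemma eps_sqr : eps * eps = 1.
Proof. by case: epsE => ->; ring. Qed.

Lemma arc_inG u : in_G (G u) (Th u).
Proof.
move: ww => [[[[[[[_ h1] h2] h3] _] _] _] _].
have cl := @clamp_in R 0 1 u ler01.
by split; [exact: h1|split; [exact: h2|exact: h3]].
Qed.

Lemma arc_phase u : phase (G u) (Th u) = eps * (eps * phase X0 th0 + T * clamp 0 1 u).
Proof. by rewrite /phase /Th /arc_angle -/(G u) addrK. Qed.

Lemma lip_clamp (F : R -> R) (k : R) :
  (forall s t, 0 <= s <= t -> t <= 1 -> `|F t - F s| <= k * (t - s)) ->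
  forall x y, `|F (clamp 0 1 x) - F (clamp 0 1 y)| <= `|k| * `|x - y|.
Proof.
move=> kF x y.
apply: (@le_trans _ _ (`|k| * `|clamp 0 1 x - clamp 0 1 y|)); last first.
  by rewrite ler_wpM2l//; exact/clamp_lip/ler01.
have := @clamp_in R 0 1 x ler01; have := @clamp_in R 0 1 y ler01.
move: (clamp 0 1 x) (clamp 0 1 y) => {}x {}y /andP[y0 y1] /andP[x0 x1].
have main a b : 0 <= a -> a <= b -> b <= 1 -> `|F b - F a| <= `|k| * `|b - a|.
  move=> a0 ab b1; apply: (@le_trans _ _ (k * (b - a))).
    by apply: kF => //; rewrite a0.
  by rewrite (ger0_norm (_ : 0 <= b - a)) ?subr_ge0// ler_wpM2r ?subr_ge0// ler_norm.
have [xy|/ltW yx] := leP x y; last exact: main.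
by rewrite distrC (distrC x); exact: main.
Qed.

Lemma arc_lip x y i j : `|G x i j - G y i j| <= `|L| * `|x - y|.
Proof.
move: ww => [[[[_ h] _] _] _].
by apply: (lip_clamp (F := fun u => arc_mx w u i j)) => s t; exact: h.
Qed.

Lemma arc_lipY x y : `|Y x - Y y| <= `|Mb| * `|x - y|.
Proof.
move: ww => [[[_ h] _] _].
by apply: (lip_clamp (F := fun u => arc_len w u)) => s t; exact: h.
Qed.

(** At a point of differentiability the integrated inclusion yields all dual inequalities for
    [(v, y')], and the bipolar property applies. The velocity is nonzero because the phase moves at
    speed [T > 0]. *)
Lemma arc_velocity x (y' : R) : 0 < x < 1 -> mx_derivable G x -> is_derive x 1 Y y' ->
  [/\ C (body_vel G x), body_vel G x != 0 & (y'%:E <= nu (body_vel G x))%E].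
Proof.
move=> /andP[x0 x1] dG dY.
have x01 : 0 <= x <= 1 by rewrite !ltW.
have detx := (arc_inG x).1.
set v := body_vel G x.
have dGij i j : is_derive x 1 (fun s => G s i j) (mx_deriv G x i j).
  by rewrite mxE; exact/derivable_isd/dG.
have vE : v = adj2 (G x) *m mx_deriv G x by rewrite /v /body_vel adj2_inv.
have gv : mx_deriv G x = G x *m v.
  by rewrite /v /body_vel mulKVmx// unitmxE detx unitr1.
have [Cv nuv] : C v /\ (y'%:E <= nu v)%E.
  apply: (nu_bipolar coneC anti usc) => f q fq; rewrite -subr_ge0.
  pose F s := mxdot ((adj2 (G x))^T *m f) (G s) - q * Y s.
  apply: (@is_derive_ge0 R F x _ (mxnorm1 f * K) (1 - x)).
  - have -> : mxdot f v = mxdot ((adj2 (G x))^T *m f) (mx_deriv G x).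
      by rewrite vE mxdot_mul.
    exact: (isdB (isd_mxdot _ dGij) (isdZ _ dY)).
  - by rewrite subr_gt0.
  - move=> h /andP[h0 hx]; rewrite /F -!mxdot_mul.
    have xh1 : x + h <= 1 by lra.
    have xh0 : 0 <= x + h by lra.
    move: ww => [_ /(_ x (x + h) f q)].
    rewrite ltW//= lerDl ltW// => /(_ isT xh1 fq).
    rewrite /G /Y !clamp_id ?x01 ?xh0 ?xh1//.
    have -> : x + h - x = h by ring.
    by rewrite mulmxBr mxdotB; lra.
split=> //; apply/eqP => v0.
have G'0 i j : is_derive x 1 (fun s => G s i j) ((G x *m (0 : M)) i j).
  by have := dGij i j; rewrite gv v0.
have dph : is_derive x 1 (fun s => phase (G s) (Th s)) (eps * T).
  have : is_derive x 1 (fun s => eps * (eps * phase X0 th0 + T * s)) (eps * (0 + T * 1)).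
    exact: (isdZ _ (isdD (isd_cst _ _) (isdZ _ (isd_id _)))).
  rewrite add0r mulr1; apply: near_eq_is_derive; near=> s.
  rewrite arc_phase clamp_id//.
  suff /andP[s0 s1] : 0 < s < 1 by rewrite !ltW.
  by near: s; apply: (@near_in_itvoo _ 0 1 x); rewrite in_itv/= x0.
(* For [v = 0] the phase estimate holds with both orientations, which would force [eps * T = 0]. *)
have ph e : e = 1 \/ e = -1 -> 0 <= e * (eps * T).
  move=> eE; have := @phase_derive_ge R G Th x (eps * T) 1 e 0 0 ltr01 (fun s _ => arc_inG s)
    G'0 dph eE ltr01.
  rewrite !mxE => /(_ (esym (oppr0 _))).
  have -> : e * (0 - 0) / 2 = 0 by ring.
  have -> : 0 ^+ 2 + ((0 + 0) / 2) ^+ 2 = ((1 - 0) * 0) ^+ 2 :> R by ring.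
  by rewrite /= !mulr0; apply.
have h1 := ph 1 (or_introl erefl); have h2 := ph (-1) (or_intror erefl).
by case: epsE h1 h2 => ->; have := T0; lra.
Unshelve. all: by end_near. Qed.

Lemma ae_neq (a : R) : {ae mu, forall x, x != a}.
Proof.
exists [set a]; split => //; first exact: lebesgue_measure_set1.
by move=> x /= /negP; rewrite negbK => /eqP.
Qed.

Lemma arc_ae_derivable : {ae mu, forall x, 0 < x < 1 -> mx_derivable G x}.
Proof.
have H i j := lipschitz_ae_derivable (fun x y (_ : 0 <= x <= 1) (_ : 0 <= y <= 1) => arc_lip x y i j).
have f1 := @filterI _ _ (ae_filter_ringOfSetsType mu) _ _ (H 0 0) (H 0 1).
have f2 := @filterI _ _ (ae_filter_ringOfSetsType mu) _ _ (H 1 0) (H 1 1).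
apply: (@filterS2 _ _ (ae_filter_ringOfSetsType mu) _ _ _ _ f1 f2).
move=> x [h1 h2] [h3 h4] x01 i j.
by have [->|->] := ord2P i; have [->|->] := ord2P j; [exact: h1|exact: h2|exact: h3|exact: h4].
Qed.

Lemma arc_admissible : admissible C 1 G Th.
Proof.
split=> //.
- by move=> t _; exact: arc_inG.
- by exists `|L| => s t i j _ _; exact: arc_lip.
- have cTh : continuous Th.
    apply: ctsD; last first.
      apply: mquot_continuous => i j; apply: lipschitz_continuous_real => x y.
      exact: arc_lip.
    apply: ctsM; first exact: cts_cst.
    apply: ctsD; first exact: cts_cst.
    apply: ctsM; first exact: cts_cst.
    apply: (@lipschitz_continuous_real R _ 1) => x y.
    by rewrite mul1r; exact/clamp_lip/ler01.
  move=> t _ e e0; have /cvgrPdist_lt/(_ _ e0)/nbhs_ballP[d /= d0 Hd] := cTh t.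
  exists d => // s _ st; rewrite distrC; apply: Hd.
  by rewrite /ball/= distrC.
have dY := lipschitz_ae_derivable (fun x y (_ : 0 <= x <= 1) (_ : 0 <= y <= 1) => arc_lipY x y).
have n01 := @filterI _ _ (ae_filter_ringOfSetsType mu) _ _ (ae_neq 0) (ae_neq 1).
have dGY := @filterI _ _ (ae_filter_ringOfSetsType mu) _ _ arc_ae_derivable dY.
apply: (@filterS2 _ _ (ae_filter_ringOfSetsType mu) _ _ _ _ n01 dGY).
move=> x [nx0 nx1] [dG dYx]; rewrite in_itv/= => /andP[x0 x1].
have x01 : 0 < x < 1 by rewrite !lt_neqAle x0 x1 eq_sym nx0 nx1.
have [Cv v0 _] := arc_velocity x01 (dG x01) (derivable_isd (dYx x01)).
by split=> //; exact: dG.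
Qed.

(** [arc_len w 1] is the integral of the derivative of [Y], which is at most [nu] of the velocity
    almost everywhere. *)
Lemma arc_length_ge : ((arc_len w 1)%:E <= curve_length nu 1 G)%E.
Proof.
have [h [hi dh hE]] := lipschitz_density ltr01 (fun x y (_ : 0 <= x <= 1) (_ : 0 <= y <= 1) => arc_lipY x y).
have Y0 : Y 0 = 0.
  rewrite /Y clamp_id; last by rewrite lexx ler01.
  by move: ww => [[[[[[[[_ ->]]]]]]]].
have Y1 : Y 1 = arc_len w 1 by rewrite /Y clamp_id// lexx ler01.
have -> : (arc_len w 1)%:E = (\int[mu]_(x in `[0%R, 1%R]%classic) (h x)%:E)%E.
  have -> : arc_len w 1 = Y 1 - Y 0 by rewrite Y0 subr0 Y1.
  by rewrite -hE /Rintegral fineK//; apply: integrable_fin_num.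
apply: integral_ge_ae => //.
have n01 := @filterI _ _ (ae_filter_ringOfSetsType mu) _ _ (ae_neq 0) (ae_neq 1).
have dGY := @filterI _ _ (ae_filter_ringOfSetsType mu) _ _ arc_ae_derivable dh.
apply: (@filterS2 _ _ (ae_filter_ringOfSetsType mu) _ _ _ _ n01 dGY).
move=> x [nx0 nx1] [dG dYx] /=; rewrite in_itv/= => /andP[x0 x1].
have x01 : 0 < x < 1 by rewrite !lt_neqAle x0 x1 eq_sym nx0 nx1.
have [Cv v0 nuv] := arc_velocity x01 (dG x01) (dYx x01).
by split=> //; have [_ pos _ _ _] := anti; exact: pos.
Qed.
End LimitCurve.
End Arcs.

(** * Admissible curves as arcs *)

Section Curves.
Variables (R : realType) (C : set 'M[R]_2) (nu : 'M[R]_2 -> \bar R).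
Notation M := 'M[R]_2.
Notation mu := (@lebesgue_measure R).
Hypothesis coneC : closed_convex_acute_cone C.
Hypothesis anti : anti_norm C nu.
Variables (eps delta : R).
Hypothesis epsE : eps = 1 \/ eps = -1.
Hypothesis delta01 : 0 < delta < 1.
Hypothesis gap : forall v, C v -> let al := eps * (v 1 0 - v 0 1) / 2 in
    [/\ 0 <= al, v != 0 -> 0 < al &
     v 0 0 ^+ 2 + ((v 0 1 + v 1 0) / 2) ^+ 2 <= ((1 - delta) * al) ^+ 2].
Variable f0 : M.
Hypothesis f0nu : forall v, C v -> fine (nu v) <= mxdot f0 v.

Import HBNNSimple.

(** The primitive of each simple function below the integrand is an eligible [y], whose increment is
    the integral of that function. *)
Lemma curve_length_le (t1 : R) (g : R -> M) (b : R) : 0 <= t1 ->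
  (forall y h : R -> R, lip 0 t1 y ->
    {ae mu, forall x, 0 < x < t1 -> is_derive x 1 y (h x)} ->
    (forall x, 0 < x < t1 -> C (body_vel g x) ->
       0 <= h x <= fine (nu (body_vel g x))) ->
    y t1 - y 0 <= b) ->
  (curve_length nu t1 g <= b%:E)%E.
Proof.
move=> t10 H; apply: integral_le_nnsfun => h hf.
have h0 x : 0 <= h x by exact: fun_ge0.
have hout x : ~ (0 <= x <= t1) -> h x = 0.
  move=> nx; have := hf x; rewrite patchE memNset; last by rewrite /= in_itv.
  by rewrite lee_fin => hx; apply/eqP; rewrite eq_le hx h0.
have [k [_ hk]] := simple_bounded h.
have hb x : 0 <= h x <= `|k| + 1.
  rewrite h0/= (le_trans (ler_norm _))//; apply: (hk (`|k| + 1)) => //.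
  by rewrite (le_lt_trans (ler_norm _))// ltrDl.
have mh : measurable_fun setT (h : R -> R) 
  by exact: (@measurable_funPT _ _ (measurableTypeR R) R h).
have [y [y0 ly dy yE]] := bounded_primitive t10 mh hb hout.
rewrite [leLHS]yE lee_fin -[y t1]subr0 -y0.
apply: (H y h) => //; first by exists (`|k| + 1).
move=> x /andP[x0 xt] Cv; rewrite h0/=.
have := hf x; rewrite patchE mem_set; last by rewrite /= in_itv/= !ltW.
have [_ pos _ _ _] := anti.
rewrite funeposE (max_idPl (pos _ Cv)) (nu_fin anti Cv) lee_fin.
by [].
Qed.

(** The curve is reparametrised by [tau], rescaled to [[0, 1]]. The constants in [arcs] depend only
    on [C], [nu] and the end points (through [delta], [f0], [T] and [X0]), so all competitors land
    in one set. *)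
Lemma arc_of_curve (t1 : R) (g : R -> M) (th : R -> R) (y h : R -> R)
    (X0 X1 : M) (th0 th1 : R) (T := eps * (phase X1 th1 - phase X0 th0)) :
  admissible C t1 g th -> from_to t1 g th X0 th0 X1 th1 -> 0 < T ->
  lip 0 t1 y -> {ae mu, forall x, 0 < x < t1 -> is_derive x 1 y (h x)} ->
  (forall x, 0 < x < t1 -> C (body_vel g x) ->
     0 <= h x <= fine (nu (body_vel g x))) ->
  exists2 w, arcs C nu eps T X0 X1 th0 (glip delta T X0 * T) (ylip delta f0 * T)
      (incl_cst delta T X0 * T ^+ 2) (gbound delta T X0 + `|ylip delta f0| * T) w &
    arc_len w 1 = y t1 - y 0.
Proof.
move=> adm [g0E th0E g1E th1E] T0 ly dy hnu.
have [t10 inG _ _ _] := adm.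
pose ta := tau eps g th.
have ta0 : ta 0 = eps * phase X0 th0 by rewrite /ta /tau g0E th0E.
have TE : ta t1 - ta 0 = T by rewrite ta0 /ta /tau g1E th1E /T; ring.
have eps2 := eps_sqr epsE.
have ctau : continuous (fun x => ta (clamp 0 t1 x)).
  have [k [k0 kt]] := lip_pos (cand_liptau eps adm).
  apply: (@lipschitz_continuous_real R _ k) => x z.
  apply: (le_trans (kt _ _ (clamp_in _ t10) (clamp_in _ t10))).
  by rewrite ler_wpM2l//; exact: clamp_lip.
have exr u : exists x, 0 <= u <= 1 -> 0 <= x <= t1 /\ ta x = ta 0 + T * u.
  have [u01|nu01] := boolP (0 <= u <= 1); last by exists 0.
  have /andP[u0 u1] := u01.
  have [|c] := @IVT R (fun x => ta (clamp 0 t1 x)) 0 t1 (ta 0 + T * u) t10 (continuous_subspaceT ctau).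
    rewrite !clamp_id ?lexx ?t10// (min_idPl _) ?(max_idPr _); first last.
    - by rewrite -subr_ge0 TE ltW.
    - by rewrite -subr_ge0 TE ltW.
    by apply/andP; split; nra.
  rewrite in_itv/= => c01; rewrite clamp_id// => cE; exists c => _.
  by split.
(* Any preimage under [tau] will do, since increments of [g] and [y] are bounded by those of
   [tau]. *)
pose r u := sval (cid (exr u)).
have rP u : 0 <= u <= 1 -> 0 <= r u <= t1 /\ ta (r u) = ta 0 + T * u.
  by rewrite /r; case: cid.
have rle s t : 0 <= s <= t -> t <= 1 -> [/\ 0 <= r s, r s <= r t, r t <= t1 &
    ta (r t) - ta (r s) = T * (t - s)].
  move=> /andP[s0 st] t1'.
  have [/andP[a1 a2] a3] : 0 <= r s <= t1 /\ ta (r s) = ta 0 + T * s.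
    by apply: rP; rewrite s0 (le_trans st).
  have [/andP[b1 b2] b3] : 0 <= r t <= t1 /\ ta (r t) = ta 0 + T * t.
    by apply: rP; rewrite t1' (le_trans s0 st).
  split=> //; last by rewrite a3 b3; ring.
  move: st; rewrite le_eqVlt => /predU1P[->//|st]; rewrite leNgt; apply/negP => rts.
  have := cand_tau coneC epsE delta01 gap adm b1 (ltW rts) a2.
  by rewrite -/ta a3 b3; nra.
(* The value zero off [[0, 1]] keeps the uniform bound valid at every index. *)
pose w : pw R (arc_index R) := fun uo => if 0 <= uo.1 <= 1 then
  (if uo.2 is Some ij then g (r uo.1) ij.1 ij.2 else y (r uo.1) - y 0) else 0.
have wg u : 0 <= u <= 1 -> arc_mx w u = g (r u).
  by move=> u01; apply/matrixP => i j; rewrite mxE /w /= u01.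
have wy u : 0 <= u <= 1 -> arc_len w u = y (r u) - y 0.
  by move=> u01; rewrite /arc_len /w /= u01.
have i00 : 0 <= (0 : R) <= 1 by rewrite lexx ler01.
have i11 : 0 <= (1 : R) <= 1 by rewrite lexx ler01.
have [/andP[r00 r01] r0t] := rP 0 i00; have [/andP[r10 r11] r1t] := rP 1 i11.
(* [r 0] may differ from [0], but [tau] agrees at both, hence so does [g]. *)
have gr0 : g (r 0) = X0.
  apply/matrixP => i j; rewrite -g0E; apply/eqP; rewrite -subr_eq0 -normr_le0.
  have := cand_lipschitz coneC epsE delta01 gap adm TE g0E i j (lexx 0) r00 r01.
  by rewrite -/ta r0t => /le_trans; apply; rewrite mulr0 addr0 subrr mulr0.
have gr1 : g (r 1) = X1.
  apply/matrixP => i j; rewrite -g1E; apply/eqP; rewrite eq_sym -subr_eq0 -normr_le0.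
  have := cand_lipschitz coneC epsE delta01 gap adm TE g0E i j r10 r11 (lexx t1).
  have -> : tau eps g th t1 - tau eps g th (r 1) = 0 by rewrite -/ta r1t -TE; ring.
  by rewrite mulr0.
have yr0 : y (r 0) = y 0.
  have := cand_y coneC epsE delta01 gap f0nu adm ly dy hnu (lexx 0) r00 r01.
  rewrite -/ta r0t mulr0 addr0 subrr mulr0 => /andP[h1 h2]; lra.
have yr1 : y (r 1) = y t1.
  have := cand_y coneC epsE delta01 gap f0nu adm ly dy hnu r10 r11 (lexx t1).
  have -> : tau eps g th t1 - tau eps g th (r 1) = 0 by rewrite -/ta r1t -TE; ring.
  rewrite mulr0 => /andP[h1 h2]; lra.
have angle u : 0 <= u <= 1 -> in_G (arc_mx w u) (arc_angle eps T X0 th0 w u).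
  move=> u01; have [ru tu] := rP u u01; rewrite wg//.
  suff -> : arc_angle eps T X0 th0 w u = th (r u) by exact: inG.
  by rewrite /arc_angle wg// -ta0 -tu /ta /tau mulrA eps2 mul1r /phase subrK.
exists w; last by rewrite wy// yr1.
rewrite /arcs; do ?split.
- by move=> i j; rewrite wg// gr0.
- by move=> i j; rewrite wg// gr1.
- by rewrite /= wy// yr0 subrr.
- by move=> u /angle [].
- by move=> u /angle [_ []].
- by move=> u /angle [_ []].
- move=> s t i j st t1'; have [h1 h2 h3 h4] := rle s t st t1'.
  have /andP[s0 s_t] := st.
  rewrite !wg ?s0 ?(le_trans s_t) ?(le_trans s0 s_t)// -mulrA -h4.
  exact: (cand_lipschitz coneC epsE delta01 gap adm TE g0E).
- move=> s t st t1'; have [h1 h2 h3 h4] := rle s t st t1'.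
  have /andP[s0 s_t] := st.
  rewrite !wy ?s0 ?(le_trans s_t) ?(le_trans s0 s_t)// -mulrA -h4.
  have -> : y (r t) - y 0 - (y (r s) - y 0) = y (r t) - y (r s) by ring.
  have /andP[h5 h6] := cand_y coneC epsE delta01 gap f0nu adm ly dy hnu h1 h2 h3.
  by rewrite ger0_norm.
- have B0 : 0 <= gbound delta T X0.
    exact: le_trans (cand_bound coneC epsE delta01 gap adm TE g0E 0 0 (lexx 0) t10).
  have M0 : 0 <= `|ylip delta f0| * T by rewrite mulr_ge0// ltW.
  move=> [u o] /=; rewrite /w /=; case: ifPn => u01; last by rewrite normr0 addr_ge0.
  have [/andP[ru0 ru1] tu] := rP u u01.
  case: o => [[i j]|] /=.
    by apply: (le_trans (cand_bound coneC epsE delta01 gap adm TE g0E i j ru0 ru1)); rewrite lerDl.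
  have /andP[h5 h6] := cand_y coneC epsE delta01 gap f0nu adm ly dy hnu (lexx 0) ru0 ru1.
  rewrite ger0_norm//; apply: (le_trans h6).
  apply: (@le_trans _ _ (`|ylip delta f0| * T)); last by rewrite lerDr.
  have -> : tau eps g th (r u) - tau eps g th 0 = T * u by rewrite -/ta tu; ring.
  have /andP[u0 u1] := u01.
  apply: (@le_trans _ _ (`|ylip delta f0| * (T * u))).
    by apply: ler_wpM2r; [rewrite mulr_ge0// ltW|exact: ler_norm].
  by apply: ler_wpM2l => //; rewrite ler_piMr// ltW.
- move=> s t f q st t1' fq; have [h1 h2 h3 h4] := rle s t st t1'.
  have /andP[s0 s_t] := st.
  rewrite !wy ?s0 ?(le_trans s_t) ?(le_trans s0 s_t)//.
  rewrite !wg ?s0 ?(le_trans s_t) ?(le_trans s0 s_t)//.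
  have -> : y (r t) - y 0 - (y (r s) - y 0) = y (r t) - y (r s) by ring.
  have -> : mxnorm1 f * (incl_cst delta T X0 * T ^+ 2) * (t - s) ^+ 2 =
    mxnorm1 f * incl_cst delta T X0 * (ta (r t) - ta (r s)) ^+ 2 by rewrite h4; ring.
  exact: (cand_incl coneC epsE delta01 gap adm TE g0E ly dy hnu).
Qed.
End Curves.

(** * Existence of a longest arc *)

Lemma longest_arc_of_bound (R : realType) (C : set 'M[R]_2) (nu : 'M[R]_2 -> \bar R)
    (X0 X1 : 'M[R]_2) (th0 th1 t1 b : R) (g : R -> 'M[R]_2) (th : R -> R) :
  admissible C t1 g th -> from_to t1 g th X0 th0 X1 th1 ->
  (b%:E <= curve_length nu t1 g)%E ->
  (forall t1 g th, admissible C t1 g th -> from_to t1 g th X0 th0 X1 th1 ->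
     (curve_length nu t1 g <= b%:E)%E) ->
  longest_arc C nu X0 th0 X1 th1 t1 g th.
Proof.
move=> adm ft ge le.
have lE : curve_length nu t1 g = b%:E by apply/eqP; rewrite eq_le ge andbT; exact: le adm ft.
have supE : sup_length C nu X0 th0 X1 th1 = b%:E.
  apply/eqP; rewrite eq_le; apply/andP; split.
    by apply: ge_ereal_sup => _ [s [g' [th' [adm' ft' ->]]]]; exact: le adm' ft'.
  by rewrite -lE; apply: ereal_sup_ubound; exists t1, g, th.
by split=> //; rewrite supE.
Qed.

Theorem theorem4 (R : realType) (C : set 'M[R]_2) (nu : 'M[R]_2 -> \bar R) :
  closed_convex_acute_cone C ->
  anti_norm C nu ->
  upper_semicontinuous nu ->
  (forall v, C v -> v != 0 -> in_int_killing_cone v) ->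
  forall (X0 : 'M[R]_2) (th0 : R) (X1 : 'M[R]_2) (th1 : R),
    in_G X0 th0 ->
    attainable C X0 th0 X1 th1 ->
    exists t1 g th, longest_arc C nu X0 th0 X1 th1 t1 g th.
Proof.
move=> coneC anti usc intC X0 th0 X1 th1 G0 [t1 [g [th [adm ft]]]].
have [eps [delta [epsE d01 gap]]] := cone_gap coneC intC.
have eps2 := eps_sqr epsE.
have [f0 f0nu] := nu_majorant coneC anti usc.
pose T := eps * (phase X1 th1 - phase X0 th0).
have TE s g' th' : from_to s g' th' X0 th0 X1 th1 -> tau eps g' th' s - tau eps g' th' 0 = T.
  by move=> [h1 h2 h3 h4]; rewrite /tau h1 h2 h3 h4 /T; ring.
have T_ge0 : 0 <= T.
  have [t10 _ _ _ _] := adm.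
  by rewrite -(TE _ _ _ ft) subr_ge0 (cand_tau coneC epsE d01 gap adm).
move: T_ge0; rewrite le_eqVlt => /predU1P[T0|T0].
  (* If [T = 0], all competitors are constant and have length zero; the constant curve on [[0, 0]]
     is a longest arc, its velocity condition bearing on a null set only. *)
  have X10 : X1 = X0.
    have [t10 _ _ _ _] := adm; have [g0E _ g1E _] := ft.
    apply/matrixP => i j; apply/eqP; rewrite -subr_eq0 -normr_le0 -g1E -g0E.
    have := cand_lipschitz coneC epsE d01 gap adm (TE _ _ _ ft) g0E i j (lexx 0) t10 (lexx t1).
    by rewrite TE// -T0 mulr0.
  have th10 : th1 = th0.
    have : eps * T = phase X1 th1 - phase X0 th0 by rewrite /T mulrA eps2 mul1r.
    by rewrite -T0 mulr0 X10 /phase; lra.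
  exists 0, (fun=> X0), (fun=> th0); apply: (@longest_arc_of_bound _ _ _ _ _ _ _ _ 0).
  - split=> //.
    + by exists 0 => s t i j _ _; rewrite subrr normr0 mul0r.
    + by move=> t _ e e0; exists 1 => // s _ _; rewrite subrr normr0.
    + apply: filterS (ae_neq 0); first exact: (ae_filter_ringOfSetsType (@lebesgue_measure R)).
      move=> t t0; rewrite in_itv/= => /andP[h1 h2].
      by move: t0; rewrite eq_le h1 h2.
  - by rewrite X10 th10.
  - by rewrite /curve_length set_itv1 integral_set1.
  - move=> s g' th' adm' ft'; have [s0 _ _ _ _] := adm'.
    apply: (curve_length_le anti) => // y h ly dy hnu.
    have /andP[_] := cand_y coneC epsE d01 gap f0nu adm' ly dy hnu (lexx 0) s0 (lexx s).
    by rewrite TE// -T0 mulr0.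
(* The attaining curve with [y = 0] shows that the compact set is nonempty. *)
have [w0 ww0 _] : exists2 w, arcs C nu eps T X0 X1 th0 (glip delta T X0 * T) (ylip delta f0 * T)
      (incl_cst delta T X0 * T ^+ 2) (gbound delta T X0 + `|ylip delta f0| * T) w & arc_len w 1 = 0 - 0.
  apply: (@arc_of_curve _ _ nu coneC _ _ epsE d01 gap _ f0nu t1 g th (fun=> 0) (fun=> 0) _ _ _ th1) => //.
  - exact: lip_cst.
  - by apply: aeW => x _; exact: isd_cst.
  - by move=> x _ Cv; rewrite lexx fine_ge0//; have [_ pos _ _ _] := anti; exact: pos.
have [w ww maxw] := arcs_max (ex_intro _ w0 ww0).
exists 1, (fun u => arc_mx w (clamp 0 1 u)), (fun u => arc_angle eps T X0 th0 w (clamp 0 1 u)).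
have c0 : clamp 0 1 0 = 0 :> R by rewrite clamp_id// lexx ler01.
have c1 : clamp 0 1 1 = 1 :> R by rewrite clamp_id// lexx ler01.
have gw0 : arc_mx w 0 = X0.
  by apply/matrixP => i j; move: ww => [[[[[[[[[-> _]]]]]]]]].
have gw1 : arc_mx w 1 = X1.
  by apply/matrixP => i j; move: ww => [[[[[[[[[_ ->]]]]]]]]].
apply: (@longest_arc_of_bound _ _ _ _ _ _ _ _ (arc_len w 1)).
- exact: (arc_admissible coneC anti usc epsE T0 ww).
- split; rewrite ?c0 ?c1 ?gw0 ?gw1//.
    by rewrite /arc_angle gw0 mulr0 addr0 mulrA eps2 mul1r /phase subrK.
  rewrite /arc_angle gw1 mulr1 /T.
  have -> : eps * (eps * phase X0 th0 + eps * (phase X1 th1 - phase X0 th0)) =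
    eps * eps * phase X1 th1 by ring.
  by rewrite eps2 mul1r /phase subrK.
- exact: (arc_length_ge coneC anti usc epsE T0 ww).
- move=> s g' th' adm' ft'; have [s0 _ _ _ _] := adm'.
  apply: (curve_length_le anti) => // y h ly dy hnu.
  (* Each competitor with its [y] is an arc of the same set, so its increment is at most the
     maximum. *)
  have [w' ww' <-] := arc_of_curve coneC epsE d01 gap f0nu adm' ft' T0 ly dy hnu.
  exact: maxw.
Qed.
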